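(* Let $\mathcal{A}$ be an abelian category and let $\mathcal{C}\subset\mathcal{A}$ be an almost split localizing subcategory, with canonical functor $\mathscr{Q}:\mathcal{A}\to\mathcal{A}/\mathcal{C}$. Then for every integer $c\ge 0$, every $\mathcal{C}$-torsion-free object $M\in\mathcal{A}$ and every $\mathcal{C}$-saturated object $N\in\mathcal{A}$, the binatural transformation $$\mathscr{Q}^{\mathrm{Ext}}:\ \varinjlim_{M'\le M,\ M/M'\in\mathcal{C}}\mathrm{Ext}^c_{\mathcal{A}}(M',N)\ \longrightarrow\ \mathrm{Ext}^c_{\mathcal{A}/\mathcal{C}}(\mathscr{Q}(M),\mathscr{Q}(N))$$ is an isomorphism of abelian groups.
   Context: A non-empty full subcategory $\mathcal{C}$ of an abelian category $\mathcal{A}$ is thick if it is closed under passing to subobjects, factor objects and extensions. The Serre quotient $\mathcal{A}/\mathcal{C}$ has the same objects as $\mathcal{A}$ and $\mathrm{Hom}_{\mathcal{A}/\mathcal{C}}(M,N)=\varinjlim \mathrm{Hom}_{\mathcal{A}}(M',N/N')$ over subobjects $M'\le M$, $N'\le N$ with $M/M',N'\in\mathcal{C}$; the canonical functor $\mathscr{Q}:\mathcal{A}\to\mathcal{A}/\mathcal{C}$ is the identity on objects, sends a morphism to its class, and is exact. A thick subcategory $\mathcal{C}$ is localizing if $\mathscr{Q}$ admits a right adjoint $\mathscr{S}:\mathcal{A}/\mathcal{C}\to\mathcal{A}$. An object $M\in\mathcal{A}$ is $\mathcal{C}$-torsion-free if it has no nonzero subobjects in $\mathcal{C}$. It is $\mathcal{C}$-saturated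 if it is $\mathcal{C}$-torsion-free and every short exact sequence $0\to M\to E\to C\to 0$ with $C\in\mathcal{C}$ splits (for localizing $\mathcal{C}$, equivalently, the unit $M\to(\mathscr{S}\circ\mathscr{Q})(M)$ is an isomorphism). For $a\in\mathcal{A}$, an almost $\mathcal{C}$-complement is a subobject $a^\perp\le a$ such that $a^\perp$ is $\mathcal{C}$-torsion-free and $a/a^\perp\in\mathcal{C}$. The thick subcategory $\mathcal{C}$ is almost split if every object $a\in\mathcal{A}$ has an almost $\mathcal{C}$-complement. ''Almost split localizing'' means almost split and localizing. $\mathrm{Ext}^c$ is Yoneda's Ext: $\mathrm{Ext}^0=\mathrm{Hom}$, and for $c>0$ elements of $\mathrm{Ext}^c(M,N)$ are classes of exact sequences $0\leftarrow M\leftarrow G_c\leftarrow\cdots\leftarrow G_1\leftarrow N\leftarrow 0$ under the equivalence relation generated by chain morphisms that are the identity on $M$ and $N$. No existence of enough projectives or injectives is assumed. The direct limit is taken over all subobjects $M'\le M$ with $M/M'\in\mathcal{C}$, ordered by reverse inclusion, where for $M''\le M'$ the transition map $\mathrm{Ext}^c_{\mathcal{A}}(M',N)\to\mathrm{Ext}^c_{\mathcal{A}}(M'',N)$ is the Yoneda composition with (pullback along) the inclusion $M''\hookrightarrow M'$. The map $\mathscr{Q}^{\mathrm{Ext}}$ is induced by the compositions $\mathrm{Ext}^c_{\mathcal{A}}(M',N)\to\mathrm{Ext}^c_{\mathcal{A}/\mathcal{C}}(\mathscr{Q}(M'),\mathscr{Q}(N))\xrightarrow{\ \cong\ }\mathrm{Ext}^c_{\mathcal{A}/\mathcal{C}}(\mathscr{Q}(M),\mathscr{Q}(N))$,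 where the first map applies the exact functor $\mathscr{Q}$ to representing exact sequences (to morphisms if $c=0$) and the second is the inverse of the isomorphism induced by $\mathscr{Q}(M'\hookrightarrow M)$, which is an isomorphism in $\mathcal{A}/\mathcal{C}$. Functoriality of the left-hand side: for $\phi:M\to L$ and $L'\le L$ with $L/L'\in\mathcal{C}$, a class in $\mathrm{Ext}^c_{\mathcal{A}}(L',N)$ is pulled back along $\phi^{-1}(L')\to L'$; in $N$ it is the usual functoriality of $\mathrm{Ext}^c_{\mathcal{A}}(M',-)$. *)

(* Defs.v *)
From HB Require Import structures.
From mathcomp Require Import all_boot ssralg.
From mathcomp Require Import boolp.
From Stdlib Require Import Relation_Operators.

Set Implicit Arguments.
Unset Strict Implicit.
Unset Printing Implicit Defensive.

Import GRing.Theory.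
Local Open Scope ring_scope.

Record preadd := Preadd {
  ob :> Type;
  hom : ob -> ob -> zmodType;
  idm : forall x, hom x x;
  comp : forall x y z, hom y z -> hom x y -> hom x z;
  compA : forall x y z t (h : hom z t) (g : hom y z) (f : hom x y),
    comp h (comp g f) = comp (comp h g) f;
  comp1m : forall x y (f : hom x y), comp (idm y) f = f;
  compm1 : forall x y (f : hom x y), comp f (idm x) = f;
  compDl : forall x y z (g h : hom y z) (f : hom x y),
    comp (g + h) f = comp g f + comp h f;
  compDr : forall x y z (g : hom y z) (f h : hom x y),
    comp g (f + h) = comp g f + comp g h
}.

Arguments hom {p}.
Arguments idm {p}.
Arguments comp {p x y z}.

Notation "g \oc f" := (comp g f) (at level 40, left associativity) : ring_scope.

Section PreaddTheory.
Variable A : preadd.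
Implicit Types x y z w t : A.

Lemma comp0m x y z (f : hom x y) : (0 : hom y z) \oc f = 0.
Proof. by apply: (@addrI _ (0 \oc f)); rewrite -compDl !addr0. Qed.

Lemma compm0 x y z (g : hom y z) : g \oc (0 : hom x y) = 0.
Proof. by apply: (@addrI _ (g \oc 0)); rewrite -compDr !addr0. Qed.

Lemma compNm x y z (g : hom y z) (f : hom x y) : (- g) \oc f = - (g \oc f).
Proof. by apply: (@addrI _ (g \oc f)); rewrite -compDl !subrr comp0m. Qed.

Lemma compmN x y z (g : hom y z) (f : hom x y) : g \oc (- f) = - (g \oc f).
Proof. by apply: (@addrI _ (g \oc f)); rewrite -compDr !subrr compm0. Qed.

Lemma compBl x y z (g h : hom y z) (f : hom x y) :
  (g - h) \oc f = g \oc f - h \oc f.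
Proof. by rewrite compDl compNm. Qed.

Lemma compBr x y z (g : hom y z) (f h : hom x y) :
  g \oc (f - h) = g \oc f - g \oc h.
Proof. by rewrite compDr compmN. Qed.

Definition is_mono x y (f : hom x y) :=
  forall w (u v : hom w x), f \oc u = f \oc v -> u = v.

Definition is_epi x y (f : hom x y) :=
  forall w (u v : hom y w), u \oc f = v \oc f -> u = v.

Definition is_iso x y (f : hom x y) :=
  exists g : hom y x, g \oc f = idm x /\ f \oc g = idm y.

Definition is_kernel x y (f : hom x y) k (i : hom k x) :=
  f \oc i = 0 /\
  forall w (u : hom w x), f \oc u = 0 -> exists! v : hom w k, i \oc v = u.

Definition is_cokernel x y (f : hom x y) c (q : hom y c) :=
  q \oc f = 0 /\
  forall w (u : hom y w), u \oc f = 0 -> exists! v : hom c w, v \oc q = u.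

Definition is_zero z :=
  (forall x (f : hom x z), f = 0) /\ (forall x (f : hom z x), f = 0).

Definition is_biprod x y s
    (i1 : hom x s) (i2 : hom y s) (p1 : hom s x) (p2 : hom s y) :=
  [/\ p1 \oc i1 = idm x, p2 \oc i2 = idm y, p1 \oc i2 = 0, p2 \oc i1 = 0
    & i1 \oc p1 + i2 \oc p2 = idm s].

(* The image of f is the kernel of g. *)
Definition exact x y z (f : hom x y) (g : hom y z) :=
  exists k (i : hom k y) (e : hom x k),
    [/\ is_kernel g i, is_epi e & f = i \oc e].

Definition short_exact x y z (i : hom x y) (p : hom y z) :=
  [/\ is_mono i, is_epi p & exact i p].

End PreaddTheory.

Definition op_preadd (A : preadd) : preadd :=
  @Preadd (ob A) (fun x y => @hom A y x) (fun x => idm x)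
    (fun x y z g f => f \oc g)
    (fun x y z t h g f => esym (compA f g h))
    (fun x y f => compm1 f) (fun x y f => comp1m f)
    (fun x y z g h f => compDr f g h) (fun x y z g f h => compDl f h g).

Section PreaddMorphisms.
Variable A : preadd.
Implicit Types x y z w t : A.

Lemma monoP x y (f : hom x y) :
  (forall w (u : hom w x), f \oc u = 0 -> u = 0) -> is_mono f.
Proof.
move=> H w u v e; apply/eqP; rewrite -subr_eq0; apply/eqP/H.
by rewrite compBr e subrr.
Qed.

Lemma epiP x y (f : hom x y) :
  (forall w (u : hom y w), u \oc f = 0 -> u = 0) -> is_epi f.
Proof.
move=> H w u v e; apply/eqP; rewrite -subr_eq0; apply/eqP/H.
by rewrite compBl e subrr.
Qed.

Lemma mono0 x y (f : hom x y) w (u : hom w x) :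
  is_mono f -> f \oc u = 0 -> u = 0.
Proof. by move=> mf e; apply: mf; rewrite compm0. Qed.

Lemma epi0 x y (f : hom x y) w (u : hom y w) :
  is_epi f -> u \oc f = 0 -> u = 0.
Proof. by move=> mf e; apply: mf; rewrite comp0m. Qed.

Lemma mono_id x : is_mono (idm x).
Proof. by move=> w u v; rewrite !comp1m. Qed.

Lemma epi_id x : is_epi (idm x).
Proof. by move=> w u v; rewrite !compm1. Qed.

Lemma mono_comp x y z (g : hom y z) (f : hom x y) :
  is_mono g -> is_mono f -> is_mono (g \oc f).
Proof. by move=> mg mf w u v; rewrite -!compA => /mg /mf. Qed.

Lemma epi_comp x y z (g : hom y z) (f : hom x y) :
  is_epi g -> is_epi f -> is_epi (g \oc f).
Proof. by move=> eg ef w u v; rewrite !compA => /ef /eg. Qed.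

Lemma mono_of_comp x y z (g : hom y z) (f : hom x y) :
  is_mono (g \oc f) -> is_mono f.
Proof. by move=> m w u v e; apply: m; rewrite -!compA e. Qed.

Lemma epi_of_comp x y z (g : hom y z) (f : hom x y) :
  is_epi (g \oc f) -> is_epi g.
Proof. by move=> m w u v e; apply: m; rewrite !compA e. Qed.

Lemma iso_id x : is_iso (idm x).
Proof. by exists (idm x); rewrite comp1m. Qed.

Lemma iso_mono x y (f : hom x y) : is_iso f -> is_mono f.
Proof.
by case=> g [gf _] w u v e; rewrite -[u]comp1m -[v]comp1m -gf -!compA e.
Qed.

Lemma iso_epi x y (f : hom x y) : is_iso f -> is_epi f.
Proof.
by case=> g [_ fg] w u v e; rewrite -[u]compm1 -[v]compm1 -fg !compA e.
Qed.

Lemma kernel_mono x y (f : hom x y) k (i : hom k x) :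
  is_kernel f i -> is_mono i.
Proof.
case=> fi H w u v e.
have [|c [_ uc]] := H _ (i \oc u); first by rewrite compA fi comp0m.
by rewrite -(uc u erefl); apply: uc.
Qed.

Lemma kernel_lift x y (f : hom x y) k (i : hom k x) w (u : hom w x) :
  is_kernel f i -> f \oc u = 0 -> exists v, i \oc v = u.
Proof. by case=> _ H /H [v [e _]]; exists v. Qed.

Lemma mk_kernel x y (f : hom x y) k (i : hom k x) :
  f \oc i = 0 -> is_mono i ->
  (forall w (u : hom w x), f \oc u = 0 -> exists v, i \oc v = u) ->
  is_kernel f i.
Proof.
move=> e m H; split=> // w u /H [v ev]; exists v; split=> // v' ev'.
by apply: m; rewrite ev.
Qed.

End PreaddMorphisms.

Section DualPreadd.
Variable A : preadd.
Implicit Types x y z w t : A.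

Lemma cokernel_epi x y (f : hom x y) c (q : hom y c) :
  is_cokernel f q -> is_epi q.
Proof. by move=> H w u v; apply: (@kernel_mono (op_preadd A) y x f c q H). Qed.

Lemma cokernel_desc x y (f : hom x y) c (q : hom y c) w (u : hom y w) :
  is_cokernel f q -> u \oc f = 0 -> exists v, v \oc q = u.
Proof. exact: (@kernel_lift (op_preadd A) y x f c q w u). Qed.

Lemma mk_cokernel x y (f : hom x y) c (q : hom y c) :
  q \oc f = 0 -> is_epi q ->
  (forall w (u : hom y w), u \oc f = 0 -> exists v, v \oc q = u) ->
  is_cokernel f q.
Proof. exact: (@mk_kernel (op_preadd A) y x f c q). Qed.

End DualPreadd.

Record is_abelian (A : preadd) : Prop := IsAbelian {
  has_zero : exists z : A, is_zero z;
  has_biprod : forall x y : A, exists s (i1 : hom x s) (i2 : hom y s)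
    (p1 : hom s x) (p2 : hom s y), is_biprod i1 i2 p1 p2;
  has_kernel : forall (x y : A) (f : hom x y),
    exists k (i : hom k x), is_kernel f i;
  has_cokernel : forall (x y : A) (f : hom x y),
    exists c (q : hom y c), is_cokernel f q;
  mono_normal : forall (x y : A) (f : hom x y), is_mono f ->
    exists z (g : hom y z), is_kernel g f;
  epi_normal : forall (x y : A) (f : hom x y), is_epi f ->
    exists z (g : hom z x), is_cokernel g f
}.

Record abelian := Abelian {
  abelian_cat :> preadd;
  abelianP : is_abelian abelian_cat
}.

Lemma op_is_abelian (A : abelian) : is_abelian (op_preadd A).
Proof.
case: (abelianP A) => [[z [z1 z2]] bip hk hc mn en]; split.
- by exists z.
- move=> x y; have [s [i1 [i2 [p1 [p2 [e1 e2 e3 e4 e5]]]]]] := bip x y.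
  by exists s, p1, p2, i1, i2.
- by move=> x y f; apply: (hc y x f).
- by move=> x y f; apply: (hk y x f).
- by move=> x y f ef; apply: (en y x f ef).
- by move=> x y f mf; apply: (mn y x f mf).
Qed.

Definition op (A : abelian) : abelian := Abelian (op_is_abelian A).

Section AbelianTheory.
Variable A : abelian.
Implicit Types x y z w t : A.

Lemma mono_kernel_iso x y (f : hom x y) : is_mono f -> is_epi f -> is_iso f.
Proof.
move=> mf ef; have [z [g kg]] := mono_normal (abelianP A) mf.
have g0 : g = 0 by apply: (epi0 ef); case: kg.
have [|v ev] := kernel_lift (u := idm y) kg; first by rewrite compm1.
by exists v; split=> //; apply: mf; rewrite compA ev comp1m compm1.
Qed.

Definition zob : A := sval (cid (has_zero (abelianP A))).
Lemma zobP : is_zero zob.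
Proof. exact: proj2_sig (cid (has_zero (abelianP A))). Qed.

Lemma to_zob x (f : hom x zob) : f = 0. Proof. by case: zobP. Qed.
Lemma of_zob x (f : hom zob x) : f = 0. Proof. by case: zobP. Qed.

Definition bip_data x y := cid (has_biprod (abelianP A) x y).
Definition bip x y : A := sval (bip_data x y).
Definition in1_data x y := cid (proj2_sig (bip_data x y)).
Definition in1 x y : hom x (bip x y) := sval (in1_data x y).
Definition in2_data x y := cid (proj2_sig (in1_data x y)).
Definition in2 x y : hom y (bip x y) := sval (in2_data x y).
Definition pr1_data x y := cid (proj2_sig (in2_data x y)).
Definition pr1 x y : hom (bip x y) x := sval (pr1_data x y).
Definition pr2_data x y := cid (proj2_sig (pr1_data x y)).
Definition pr2 x y : hom (bip x y) y := sval (pr2_data x y).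
Lemma bipP x y : is_biprod (in1 x y) (in2 x y) (pr1 x y) (pr2 x y).
Proof. exact: proj2_sig (pr2_data x y). Qed.

Lemma pr1in1 x y : pr1 x y \oc in1 x y = idm x. Proof. by case: (bipP x y). Qed.
Lemma pr2in2 x y : pr2 x y \oc in2 x y = idm y. Proof. by case: (bipP x y). Qed.
Lemma pr1in2 x y : pr1 x y \oc in2 x y = 0. Proof. by case: (bipP x y). Qed.
Lemma pr2in1 x y : pr2 x y \oc in1 x y = 0. Proof. by case: (bipP x y). Qed.
Lemma bip_id x y : in1 x y \oc pr1 x y + in2 x y \oc pr2 x y = idm (bip x y).
Proof. by case: (bipP x y). Qed.

Definition bpair w x y (f : hom w x) (g : hom w y) : hom w (bip x y) :=
  in1 x y \oc f + in2 x y \oc g.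

Definition bcopair w x y (f : hom x w) (g : hom y w) : hom (bip x y) w :=
  f \oc pr1 x y + g \oc pr2 x y.

Lemma pr1_bpair w x y (f : hom w x) (g : hom w y) : pr1 x y \oc bpair f g = f.
Proof. by rewrite compDr !compA pr1in1 pr1in2 comp0m comp1m addr0. Qed.

Lemma pr2_bpair w x y (f : hom w x) (g : hom w y) : pr2 x y \oc bpair f g = g.
Proof. by rewrite compDr !compA pr2in1 pr2in2 comp0m comp1m add0r. Qed.

Lemma bcopair_in1 w x y (f : hom x w) (g : hom y w) :
  bcopair f g \oc in1 x y = f.
Proof. by rewrite compDl -!compA pr1in1 pr2in1 compm0 compm1 addr0. Qed.

Lemma bcopair_in2 w x y (f : hom x w) (g : hom y w) :
  bcopair f g \oc in2 x y = g.
Proof. by rewrite compDl -!compA pr1in2 pr2in2 compm0 compm1 add0r. Qed.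

Lemma bip_ext w x y (f g : hom w (bip x y)) :
  pr1 x y \oc f = pr1 x y \oc g -> pr2 x y \oc f = pr2 x y \oc g -> f = g.
Proof.
by move=> e1 e2; rewrite -[f]comp1m -[g]comp1m -bip_id !compDl -!compA e1 e2.
Qed.

Lemma bip_coext w x y (f g : hom (bip x y) w) :
  f \oc in1 x y = g \oc in1 x y -> f \oc in2 x y = g \oc in2 x y -> f = g.
Proof.
by move=> e1 e2; rewrite -[f]compm1 -[g]compm1 -bip_id !compDr !compA e1 e2.
Qed.

Lemma bcopair_pair w x y z (f : hom x z) (g : hom y z) (h : hom w x)
  (k : hom w y) : bcopair f g \oc bpair h k = f \oc h + g \oc k.
Proof. by rewrite compDl -!compA pr1_bpair pr2_bpair. Qed.

Lemma comp_copair w x y z (f : hom x w) (g : hom y w) (h : hom w z) :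
  h \oc bcopair f g = bcopair (h \oc f) (h \oc g).
Proof. by rewrite compDr !compA. Qed.

Lemma pair_comp w x y z (f : hom w x) (g : hom w y) (h : hom z w) :
  bpair f g \oc h = bpair (f \oc h) (g \oc h).
Proof. by rewrite compDl -!compA. Qed.

Definition ker_data x y (f : hom x y) := cid (has_kernel (abelianP A) f).
Definition ker x y (f : hom x y) : A := sval (ker_data f).
Definition kerm_data x y (f : hom x y) := cid (proj2_sig (ker_data f)).
Definition kerm x y (f : hom x y) : hom (ker f) x := sval (kerm_data f).
Lemma kerP x y (f : hom x y) : is_kernel f (kerm f).
Proof. exact: proj2_sig (kerm_data f). Qed.

Definition coker_data x y (f : hom x y) := cid (has_cokernel (abelianP A) f).
Definition coker x y (f : hom x y) : A := sval (coker_data f).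
Definition cokerm_data x y (f : hom x y) := cid (proj2_sig (coker_data f)).
Definition cokerm x y (f : hom x y) : hom y (coker f) :=
  sval (cokerm_data f).
Lemma cokerP x y (f : hom x y) : is_cokernel f (cokerm f).
Proof. exact: proj2_sig (cokerm_data f). Qed.

Lemma kerm_mono x y (f : hom x y) : is_mono (kerm f).
Proof. exact: kernel_mono (kerP f). Qed.

Lemma comp_kerm x y (f : hom x y) : f \oc kerm f = 0.
Proof. by case: (kerP f). Qed.

Lemma comp_cokerm x y (f : hom x y) : cokerm f \oc f = 0.
Proof. by case: (cokerP f). Qed.

End AbelianTheory.

Arguments zob {A}.

Section DualTheory.
Variable A : abelian.
Implicit Types x y z w t : A.

Lemma cokerm_epi x y (f : hom x y) : is_epi (cokerm f).
Proof. exact: cokernel_epi (cokerP f). Qed.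

(* A normal epimorphism is the cokernel of any of its kernels. *)
Lemma epi_cokernel x y (f : hom x y) k (i : hom k x) :
  is_epi f -> is_kernel f i -> is_cokernel i f.
Proof.
move=> ef ki; have [z [g cg]] := epi_normal (abelianP A) ef.
apply: mk_cokernel => //; first by case: ki.
move=> w u ui; apply: (cokernel_desc cg).
have [|v <-] := kernel_lift (u := g) ki; first by case: cg.
by rewrite compA ui comp0m.
Qed.

Definition is_pullback x y z (f : hom x z) (g : hom y z) p
    (p1 : hom p x) (p2 : hom p y) :=
  f \oc p1 = g \oc p2 /\
  forall w (u : hom w x) (v : hom w y), f \oc u = g \oc v ->
    exists! h : hom w p, p1 \oc h = u /\ p2 \oc h = v.

Lemma pullback_ex x y z (f : hom x z) (g : hom y z) :
  exists p (p1 : hom p x) (p2 : hom p y), is_pullback f g p1 p2.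
Proof.
pose d := f \oc pr1 x y - g \oc pr2 x y.
exists (ker d), (pr1 x y \oc kerm d), (pr2 x y \oc kerm d); split.
  by apply/eqP; rewrite -subr_eq0 !compA -compBl comp_kerm.
move=> w u v e; have [|h eh] := kernel_lift (u := bpair u v) (kerP d).
  by rewrite compBl -!compA pr1_bpair pr2_bpair e subrr.
exists h; split; first by rewrite -!compA eh pr1_bpair pr2_bpair.
move=> h' [e1 e2]; apply: (@kerm_mono _ _ _ d); rewrite eh.
by apply: bip_ext; rewrite ?pr1_bpair ?pr2_bpair compA ?e1 ?e2.
Qed.

Lemma pullback_lift x y z (f : hom x z) (g : hom y z) p
  (p1 : hom p x) (p2 : hom p y) w (u : hom w x) (v : hom w y) :
  is_pullback f g p1 p2 -> f \oc u = g \oc v ->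
  exists h, p1 \oc h = u /\ p2 \oc h = v.
Proof. by case=> _ H /H [h [? _]]; exists h. Qed.

Lemma pullback_ext x y z (f : hom x z) (g : hom y z) p
  (p1 : hom p x) (p2 : hom p y) w (h k : hom w p) :
  is_pullback f g p1 p2 ->
  p1 \oc h = p1 \oc k -> p2 \oc h = p2 \oc k -> h = k.
Proof.
case=> e H e1 e2; have [|l [_ ul]] := H w (p1 \oc h) (p2 \oc h).
  by rewrite !compA e.
by rewrite -(ul h) //; apply: ul.
Qed.

Lemma pullback_sym x y z (f : hom x z) (g : hom y z) p
  (p1 : hom p x) (p2 : hom p y) :
  is_pullback f g p1 p2 -> is_pullback g f p2 p1.
Proof.
case=> e H; split=> // w u v e'.
have [h [[e1 e2] uh]] := H w v u (esym e').
by exists h; split=> // h' [? ?]; apply: uh.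
Qed.

Lemma pullback_mono x y z (f : hom x z) (g : hom y z) p
  (p1 : hom p x) (p2 : hom p y) :
  is_pullback f g p1 p2 -> is_mono f -> is_mono p2.
Proof.
move=> pb mf w u v e; apply: (pullback_ext pb) => //; apply: mf.
by rewrite !compA pb.1 -!compA e.
Qed.

Lemma pullback_epi x y z (f : hom x z) (g : hom y z) p
  (p1 : hom p x) (p2 : hom p y) :
  is_pullback f g p1 p2 -> is_epi f -> is_epi p2.
Proof.
move=> pb ef; apply: epiP => w u e.
pose d := bcopair f (- g).
have ed : is_epi d.
  by apply: (@epi_of_comp _ _ _ _ d (in1 x y)); rewrite bcopair_in1.
have cd := epi_cokernel ed (kerP d).
have [|v ev] := cokernel_desc (u := bcopair 0 u) cd.
  have [|h [e1 e2]] := pullback_lift (u := pr1 x y \oc kerm d)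
                            (v := pr2 x y \oc kerm d) pb.
    apply/eqP; rewrite -subr_eq0 !compA -compBl -compNm.
    by have := comp_kerm d; rewrite {1}/d /bcopair => ->.
  by rewrite /bcopair comp0m add0r -compA -e2 compA e comp0m.
have v0 : v = 0.
  by apply: (epi0 ef); rewrite -(bcopair_in1 f (- g)) compA ev bcopair_in1.
by rewrite -(bcopair_in2 (0 : hom x w) u) -ev v0 !comp0m.
Qed.

Lemma image_ex x y (f : hom x y) :
  exists k (m : hom k y) (e : hom x k), [/\ is_mono m, is_epi e & f = m \oc e].
Proof.
have [e fe] := kernel_lift (kerP (cokerm f)) (comp_cokerm f).
set m := kerm _ in fe; exists (ker (cokerm f)), m, e.
have mm : is_mono m by apply: kerm_mono.
split=> //; apply: epiP => w u ue.
have [e' ee'] := kernel_lift (kerP u) ue.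
set k := kerm u in ee'; have mk : is_mono k by apply: kerm_mono.
have [z [g kg]] := mono_normal (abelianP A) (mono_comp mm mk).
have [|g' eg'] := cokernel_desc (u := g) (cokerP f).
  by rewrite -fe -ee' !compA -(compA g) kg.1 comp0m.
have [|j ej] := kernel_lift (u := m) kg.
  by rewrite -eg' -compA (comp_kerm (cokerm f)) compm0.
have kj : k \oc j = idm _ by apply: mm; rewrite compA ej compm1.
by rewrite -[u]compm1 -kj compA (comp_kerm u) comp0m.
Qed.

Lemma epi_chase x y (f : hom x y) w (u : hom w y) : is_epi f ->
  exists w' (e : hom w' w) (v : hom w' x), is_epi e /\ f \oc v = u \oc e.
Proof.
move=> ef; have [p [p1 [p2 pb]]] := pullback_ex f u.
exists p, p2, p1; split; [exact: pullback_epi pb ef | exact: pb.1].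
Qed.

Lemma chase_epi x y (f : hom x y) :
  (forall w (u : hom w y), exists w' (e : hom w' w) (v : hom w' x),
     is_epi e /\ f \oc v = u \oc e) -> is_epi f.
Proof.
move=> /(_ y (idm y)) [w' [e [v [ee]]]]; rewrite comp1m => fv.
by apply: (@epi_of_comp _ _ _ _ f v); rewrite fv.
Qed.

Lemma exact_chase x y z (f : hom x y) (g : hom y z) w (u : hom w y) :
  exact f g -> g \oc u = 0 ->
  exists w' (e : hom w' w) (v : hom w' x), is_epi e /\ f \oc v = u \oc e.
Proof.
case=> k [i [e0 [ki ee ->]]] gu; have [v ev] := kernel_lift ki gu.
have [w' [e [v' [ee' e']]]] := epi_chase v ee.
by exists w', e, v'; split; rewrite // -compA e' compA ev.
Qed.

Lemma exact0 x y z (f : hom x y) (g : hom y z) : exact f g -> g \oc f = 0.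
Proof. by case=> k [i [e0 [ki ee ->]]]; rewrite compA ki.1 comp0m. Qed.

Lemma chase_exact x y z (f : hom x y) (g : hom y z) : g \oc f = 0 ->
  (forall w (u : hom w y), g \oc u = 0 ->
   exists w' (e : hom w' w) (v : hom w' x), is_epi e /\ f \oc v = u \oc e) ->
  exact f g.
Proof.
move=> gf H; have [e0 fe] := kernel_lift (kerP g) gf.
exists (ker g), (kerm g), e0; split=> //; first exact: kerP.
have [w' [e [v [ee fv]]]] := H _ _ (comp_kerm g).
apply: (@epi_of_comp _ _ _ _ e0 v).
suff -> : e0 \oc v = e by [].
by apply: (@kerm_mono _ _ _ g); rewrite compA fe fv.
Qed.

Lemma kernel_exact x y z (f : hom x y) (g : hom y z) :
  is_kernel g f -> exact f g.
Proof.
by move=> kf; exists x, f, (idm x); split; rewrite ?compm1 //; apply: epi_id.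
Qed.

Lemma exact_kernel x y z (f : hom x y) (g : hom y z) :
  is_mono f -> exact f g -> is_kernel g f.
Proof.
move=> mf [k [i [e [ki ee fe]]]].
have ie : is_iso e.
  by apply: mono_kernel_iso => //; apply: (@mono_of_comp _ _ _ _ i); rewrite -fe.
apply: mk_kernel => //; first by rewrite fe compA ki.1 comp0m.
move=> w u gu; have [v <-] := kernel_lift ki gu; have [e' [_ ee']] := ie.
by exists (e' \oc v); rewrite fe -!compA (compA e) ee' comp1m.
Qed.

Lemma exact_cokernel x y z (f : hom x y) (g : hom y z) :
  is_epi g -> exact f g -> is_cokernel f g.
Proof.
move=> eg ex; apply: mk_cokernel => //; first exact: exact0.
move=> w u uf; apply: (cokernel_desc (epi_cokernel eg (kerP g))).
have [w' [e [v [ee fv]]]] := exact_chase ex (comp_kerm g).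
by apply: (epi0 ee); rewrite -compA -fv compA uf comp0m.
Qed.

Lemma cokernel_exact x y z (f : hom x y) (g : hom y z) :
  is_cokernel f g -> exact f g.
Proof.
move=> cg; have [k [m [e [mm ee fe]]]] := image_ex f.
exists k, m, e; split=> //.
have [z' [h kh]] := mono_normal (abelianP A) mm.
apply: mk_kernel => //.
  by apply: (epi0 ee); rewrite -compA -fe cg.1.
move=> w u gu; apply: (kernel_lift kh).
have [|v <-] := cokernel_desc (u := h) cg.
  by rewrite fe compA kh.1 comp0m.
by rewrite -compA gu compm0.
Qed.

Lemma exact_epi x y z (f : hom x y) : exact f (0 : hom y z) <-> is_epi f.
Proof.
split=> [ex|ef].
  apply: chase_epi => w u; apply: (exact_chase ex); exact: comp0m.
apply: chase_exact => [|w u _]; [exact: comp0m | exact: epi_chase].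
Qed.

End DualTheory.

Section MoreDual.
Variable A : abelian.
Implicit Types x y z w t : A.

Definition is_pushout x y z (f : hom z x) (g : hom z y) p
    (i1 : hom x p) (i2 : hom y p) :=
  i1 \oc f = i2 \oc g /\
  forall w (u : hom x w) (v : hom y w), u \oc f = v \oc g ->
    exists! h : hom p w, h \oc i1 = u /\ h \oc i2 = v.

Lemma pushout_ex x y z (f : hom z x) (g : hom z y) :
  exists p (i1 : hom x p) (i2 : hom y p), is_pushout f g i1 i2.
Proof. exact: (@pullback_ex (op A) x y z f g). Qed.

Lemma pushout_desc x y z (f : hom z x) (g : hom z y) p
  (i1 : hom x p) (i2 : hom y p) w (u : hom x w) (v : hom y w) :
  is_pushout f g i1 i2 -> u \oc f = v \oc g ->
  exists h, h \oc i1 = u /\ h \oc i2 = v.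
Proof. exact: (@pullback_lift (op A) x y z f g p i1 i2 w u v). Qed.

Lemma pushout_ext x y z (f : hom z x) (g : hom z y) p
  (i1 : hom x p) (i2 : hom y p) w (h k : hom p w) :
  is_pushout f g i1 i2 ->
  h \oc i1 = k \oc i1 -> h \oc i2 = k \oc i2 -> h = k.
Proof. exact: (@pullback_ext (op A) x y z f g p i1 i2 w h k). Qed.

Lemma pushout_mono x y z (f : hom z x) (g : hom z y) p
  (i1 : hom x p) (i2 : hom y p) :
  is_pushout f g i1 i2 -> is_mono f -> is_mono i2.
Proof. exact: (@pullback_epi (op A) x y z f g p i1 i2). Qed.

Lemma pushout_epi x y z (f : hom z x) (g : hom z y) p
  (i1 : hom x p) (i2 : hom y p) :
  is_pushout f g i1 i2 -> is_epi f -> is_epi i2.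
Proof. exact: (@pullback_mono (op A) x y z f g p i1 i2). Qed.

Lemma mono_kernel x y (f : hom x y) c (q : hom y c) :
  is_mono f -> is_cokernel f q -> is_kernel q f.
Proof. exact: (@epi_cokernel (op A) y x f c q). Qed.

Lemma mono_factor x y z (f : hom x z) (g : hom y z) :
  is_mono f -> (forall w (u : hom z w), u \oc f = 0 -> u \oc g = 0) ->
  exists h, f \oc h = g.
Proof.
move=> mf H; apply: (kernel_lift (mono_kernel mf (cokerP f))).
exact/H/comp_cokerm.
Qed.

End MoreDual.

Lemma epi_factor (A : abelian) (x y z : A) (f : hom z x) (g : hom z y) :
  is_epi f -> (forall w (u : hom w z), f \oc u = 0 -> g \oc u = 0) ->
  exists h, h \oc f = g.
Proof. exact: (@mono_factor (op A) x y z f g). Qed.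

Definition quot (T : Type) (R : T -> T -> Prop) : Type :=
  {P : T -> Prop | exists x, P = R x}.

HB.instance Definition _ T (R : T -> T -> Prop) := gen_eqMixin (quot R).
HB.instance Definition _ T (R : T -> T -> Prop) := gen_choiceMixin (quot R).

Definition cls T (R : T -> T -> Prop) (x : T) : quot R :=
  exist _ (R x) (ex_intro _ x erefl).

Definition repr T (R : T -> T -> Prop) (a : quot R) : T :=
  sval (cid (proj2_sig a)).

Record equivalence T (R : T -> T -> Prop) : Prop := Equivalence {
  eqv_refl : forall x, R x x;
  eqv_sym : forall x y, R x y -> R y x;
  eqv_trans : forall x y z, R x y -> R y z -> R x z
}.

Lemma reprK T (R : T -> T -> Prop) (a : quot R) : cls R (repr a) = a.
Proof.
rewrite /repr; case: cid => x /= e; case: a e => P HP /= e.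
by apply: eq_exist; rewrite /= e.
Qed.

Lemma cls_ind T (R : T -> T -> Prop) (P : quot R -> Prop) :
  (forall x, P (cls R x)) -> forall a, P a.
Proof. by move=> H a; rewrite -(reprK a). Qed.

Lemma cls_eqP T (R : T -> T -> Prop) : equivalence R ->
  forall x y, cls R x = cls R y <-> R x y.
Proof.
move=> [r s t] x y; split=> [|Rxy].
  by move/(congr1 sval) => /= e; rewrite e; apply: r.
apply: eq_exist; apply/funext => z; apply/propext; split.
  exact/t/s.
exact: t.
Qed.

Lemma repr_rel T (R : T -> T -> Prop) : equivalence R ->
  forall x, R (repr (cls R x)) x.
Proof. by move=> eR x; apply/(cls_eqP eR); rewrite reprK. Qed.

Record dirsys := Dirsys {
  ds_idx : Type;
  ds_le : ds_idx -> ds_idx -> Prop;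
  ds_obj : ds_idx -> zmodType;
  ds_map : forall i j, ds_le i j -> ds_obj i -> ds_obj j;
  ds_inh : exists i : ds_idx, True;
  ds_le_refl : forall i, ds_le i i;
  ds_le_trans : forall i j k, ds_le i j -> ds_le j k -> ds_le i k;
  ds_dir : forall i j, exists k, ds_le i k /\ ds_le j k;
  ds_map_id : forall i (h : ds_le i i) x, ds_map h x = x;
  ds_map_comp : forall i j k (h : ds_le i j) (h' : ds_le j k)
    (h'' : ds_le i k) x, ds_map h' (ds_map h x) = ds_map h'' x;
  ds_mapD : forall i j (h : ds_le i j) x y,
    ds_map h (x + y) = ds_map h x + ds_map h y
}.

Section Dirlim.
Variable D : dirsys.
Implicit Types i j k : ds_idx D.

Definition dl_rel (x y : {i : ds_idx D & ds_obj i}) : Prop :=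
  exists k (h : ds_le (projT1 x) k) (h' : ds_le (projT1 y) k),
    ds_map h (projT2 x) = ds_map h' (projT2 y).

Lemma dl_relP : equivalence dl_rel.
Proof.
split.
- by move=> [i x]; exists i, (ds_le_refl i), (ds_le_refl i).
- by move=> [i x] [j y] [k [h [h' e]]]; exists k, h', h.
move=> [i x] [j y] [l z] [k /= [h [h' e]]] [k' /= [g [g' e']]].
have [m [a b]] := ds_dir k k'.
exists m, (ds_le_trans h a), (ds_le_trans g' b) => /=.
rewrite -(ds_map_comp h a) e -(ds_map_comp g' b) -e'.
by rewrite (ds_map_comp h' a (ds_le_trans h' a)) (ds_map_comp g b (ds_le_trans h' a)).
Qed.

Definition dirlim := quot dl_rel.

HB.instance Definition _ := Choice.on dirlim.

Definition dl_in i (x : ds_obj i) : dirlim := cls dl_rel (existT _ i x).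

Lemma dl_in_eqP i j (x : ds_obj i) (y : ds_obj j) :
  dl_in x = dl_in y <->
  exists k (h : ds_le i k) (h' : ds_le j k), ds_map h x = ds_map h' y.
Proof. exact: (cls_eqP dl_relP). Qed.

Lemma dl_ind (P : dirlim -> Prop) :
  (forall i (x : ds_obj i), P (dl_in x)) -> forall a, P a.
Proof. by move=> H; apply: cls_ind => -[i x]; apply: H. Qed.

Lemma dl_in_map i j (h : ds_le i j) (x : ds_obj i) :
  dl_in (ds_map h x) = dl_in x.
Proof.
apply/dl_in_eqP; exists j, (ds_le_refl j), h; exact: ds_map_id.
Qed.

Lemma dl_ub i j : {k | ds_le i k /\ ds_le j k}.
Proof. exact: cid (ds_dir i j). Qed.

(* Addition of classes takes place over a common upper bound. *)
Definition dl_add (a b : dirlim) : dirlim :=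
  let x := repr a in let y := repr b in
  let k := dl_ub (projT1 x) (projT1 y) in
  dl_in (ds_map (proj1 (proj2_sig k)) (projT2 x)
         + ds_map (proj2 (proj2_sig k)) (projT2 y)).

Lemma dl_add_wd i j k i' j' k' (x : ds_obj i) (y : ds_obj j) (x' : ds_obj i')
    (y' : ds_obj j') (h : ds_le i k) (g : ds_le j k)
    (h' : ds_le i' k') (g' : ds_le j' k') :
  dl_in x = dl_in x' -> dl_in y = dl_in y' ->
  dl_in (ds_map h x + ds_map g y) = dl_in (ds_map h' x' + ds_map g' y').
Proof.
move=> /dl_in_eqP[l [a [a' e]]] /dl_in_eqP[m [b [b' f]]].
have [n [nl nm]] := ds_dir l m; have [o [ok ok']] := ds_dir k k'.
have [p [pn po]] := ds_dir n o.
have kp := ds_le_trans ok po; have k'p := ds_le_trans ok' po.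
have lp := ds_le_trans nl pn; have mp := ds_le_trans nm pn.
apply/dl_in_eqP; exists p, kp, k'p.
rewrite !ds_mapD; congr (_ + _).
  rewrite (ds_map_comp h kp (ds_le_trans h kp)).
  rewrite (ds_map_comp h' k'p (ds_le_trans h' k'p)).
  by rewrite -(ds_map_comp a lp) -(ds_map_comp a' lp) e.
rewrite (ds_map_comp g kp (ds_le_trans g kp)).
rewrite (ds_map_comp g' k'p (ds_le_trans g' k'p)).
by rewrite -(ds_map_comp b mp) -(ds_map_comp b' mp) f.
Qed.

Lemma dl_addE i j k (x : ds_obj i) (y : ds_obj j)
    (h : ds_le i k) (g : ds_le j k) :
  dl_add (dl_in x) (dl_in y) = dl_in (ds_map h x + ds_map g y).
Proof.
have E (a : dirlim) : dl_in (projT2 (repr a)) = a.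
  by rewrite -[RHS](reprK a) /dl_in; case: (repr a).
exact: dl_add_wd.
Qed.

Lemma dl_addE1 i (x y : ds_obj i) : dl_add (dl_in x) (dl_in y) = dl_in (x + y).
Proof. by rewrite (dl_addE x y (ds_le_refl i) (ds_le_refl i)) !ds_map_id. Qed.

Lemma dl_common (a b : dirlim) :
  exists i (x y : ds_obj i), a = dl_in x /\ b = dl_in y.
Proof.
elim/dl_ind: a => i x; elim/dl_ind: b => j y.
have [k [h h']] := ds_dir i j.
by exists k, (ds_map h x), (ds_map h' y); rewrite !dl_in_map.
Qed.

Definition dl_zero : dirlim := @dl_in (sval (cid (ds_inh D))) 0.

Lemma ds_map0 i j (h : ds_le i j) : ds_map h 0 = 0.
Proof. by apply: (@addrI _ (ds_map h 0)); rewrite -ds_mapD !addr0. Qed.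

Lemma dl_in0 i : dl_in (0 : ds_obj i) = dl_zero.
Proof.
rewrite /dl_zero; set j := sval _; have [k [h h']] := ds_dir i j.
by apply/dl_in_eqP; exists k, h, h'; rewrite !ds_map0.
Qed.

Definition dl_opp (a : dirlim) : dirlim := dl_in (- projT2 (repr a)).

Lemma dl_oppE i (x : ds_obj i) : dl_opp (dl_in x) = dl_in (- x).
Proof.
rewrite /dl_opp.
have /= := repr_rel dl_relP (existT _ i x); rewrite /dl_in.
case: (repr _) => j y [k /= [h [h' e]]].
apply/dl_in_eqP; exists k, h, h'.
apply: (@addrI _ (ds_map h y)); rewrite -ds_mapD subrr ds_map0 e.
by rewrite -ds_mapD subrr ds_map0.
Qed.

Lemma dl_addA : associative dl_add.
Proof.
move=> a b c; have [i [x [y [-> ->]]]] := dl_common a b.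
elim/dl_ind: c => j z; have [k [h h']] := ds_dir i j.
by rewrite -(dl_in_map h x) -(dl_in_map h y) -(dl_in_map h' z) !dl_addE1 addrA.
Qed.

Lemma dl_addC : commutative dl_add.
Proof.
by move=> a b; have [i [x [y [-> ->]]]] := dl_common a b; rewrite !dl_addE1 addrC.
Qed.

Lemma dl_add0 : left_id dl_zero dl_add.
Proof. by move=> a; elim/dl_ind: a => i x; rewrite -(dl_in0 i) dl_addE1 add0r. Qed.

Lemma dl_addN : left_inverse dl_zero dl_opp dl_add.
Proof.
by move=> a; elim/dl_ind: a => i x; rewrite dl_oppE dl_addE1 addNr dl_in0.
Qed.

HB.instance Definition _ :=
  GRing.isZmodule.Build dirlim dl_addA dl_addC dl_add0 dl_addN.

Lemma dl_inD i j k (x : ds_obj i) (y : ds_obj j)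
    (h : ds_le i k) (g : ds_le j k) :
  dl_in x + dl_in y = dl_in (ds_map h x + ds_map g y).
Proof. exact: dl_addE. Qed.

Lemma dl_inD1 i (x y : ds_obj i) : dl_in x + dl_in y = dl_in (x + y).
Proof. exact: dl_addE1. Qed.

Lemma dl_in0E i : dl_in (0 : ds_obj i) = 0.
Proof. exact: dl_in0. Qed.

(* The map out of a direct limit induced by a compatible family. *)
Definition dl_lift (T : Type) (f : forall i, ds_obj i -> T) (a : dirlim) : T :=
  f _ (projT2 (repr a)).

Lemma dl_liftE T (f : forall i, ds_obj i -> T) :
  (forall i j (h : ds_le i j) x, f j (ds_map h x) = f i x) ->
  forall i x, dl_lift f (@dl_in i x) = f i x.
Proof.
move=> H i x; rewrite /dl_lift.
have /= := repr_rel dl_relP (existT _ i x); rewrite /dl_in.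
by case: (repr _) => j y [k /= [h [h' e]]]; rewrite -(H _ _ h) e H.
Qed.

End Dirlim.

Section Chains.
Variable A : preadd.

(* A chain of length c is a diagram X <- G_c <- ... <- G_1 <- N. *)
Fixpoint chain (c : nat) (X N : A) : Type :=
  match c with
  | 0 => hom N X
  | c'.+1 => {G : A & (hom G X * chain c' G N)%type}
  end.

(* With g : X -> Y, the sequence Y <- X <- G_c <- ... <- G_1 <- N <- 0 is exact
   at all places except Y. *)
Fixpoint exact_from (c : nat) (X N Y : A) (g : hom X Y) :
    chain c X N -> Prop :=
  match c with
  | 0 => fun i => exact i g /\ is_mono i
  | c'.+1 => fun s => exact (projT2 s).1 g /\
                      exact_from (projT2 s).1 (projT2 s).2
  end.

Fixpoint chain_mor (c : nat) (X N X' N' : A) (f : hom X X') (g : hom N N') :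
    chain c X N -> chain c X' N' -> Prop :=
  match c with
  | 0 => fun i i' => i' \oc g = f \oc i
  | c'.+1 => fun s s' => exists h : hom (projT1 s) (projT1 s'),
      (projT2 s').1 \oc h = f \oc (projT2 s).1 /\
      chain_mor h g (projT2 s).2 (projT2 s').2
  end.

Fixpoint head_zero (c : nat) (X N Y : A) (g : hom X Y) : chain c X N -> Prop :=
  match c with
  | 0 => fun i => g \oc i = 0
  | c'.+1 => fun s => g \oc (projT2 s).1 = 0
  end.

Lemma chain_mor_id c (X N : A) (s : chain c X N) :
  chain_mor (idm X) (idm N) s s.
Proof.
elim: c X s => [|c IH] X /= s; first by rewrite compm1 comp1m.
by exists (idm _); rewrite compm1 comp1m; split.
Qed.

Lemma chain_mor_comp c (X N X' N' X'' N'' : A) (f : hom X X') (g : hom N N')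
  (f' : hom X' X'') (g' : hom N' N'') (s : chain c X N) (t : chain c X' N')
  (u : chain c X'' N'') :
  chain_mor f g s t -> chain_mor f' g' t u ->
  chain_mor (f' \oc f) (g' \oc g) s u.
Proof.
elim: c X X' X'' f f' s t u => [|c IH] X X' X'' f f' /= s t u.
  by move=> e e'; rewrite compA e' -!compA e.
move=> [h [e H]] [h' [e' H']]; exists (h' \oc h); split; last exact: IH H H'.
by rewrite compA e' -!compA e.
Qed.

End Chains.

Section ExactChains.
Variable A : abelian.
Implicit Types X Y M N G : A.

Definition exact_seq c M N (s : chain c M N) : Prop :=
  exact_from (0 : hom M zob) s.

Lemma exact_from_head c X N Y (g : hom X Y) (s : chain c X N) :
  exact_from g s -> head_zero g s.
Proof. by case: c s => [|c] s /= [/exact0]. Qed.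

Lemma exact_from_ker c X N Y Y' (g : hom X Y) (g' : hom X Y')
    (s : chain c X N) :
  (forall W (v : hom W X), g \oc v = 0 <-> g' \oc v = 0) ->
  exact_from g s -> exact_from g' s.
Proof.
move=> H.
have E X0 (d : hom X0 X) : exact d g -> exact d g'.
  move=> ex; apply: chase_exact; first exact/H/exact0.
  by move=> W u /H; apply: exact_chase.
by case: c s => [|c] s /= [/E].
Qed.

Lemma chain_lift c G N M (d : hom G M) (r : chain c G N) G' M'
    (d' : hom G' M') (u : hom G' G) :
  exact_from d r ->
  (forall W (v : hom W G), d \oc v = 0 ->
     exists v', u \oc v' = v /\ d' \oc v' = 0) ->
  (forall W (v : hom W G'), u \oc v = 0 -> d' \oc v = 0 -> v = 0) ->
  (forall W (v : hom W G'), d' \oc v = 0 -> d \oc (u \oc v) = 0) ->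
  exists r' : chain c G' N,
    [/\ exact_from d' r', chain_mor u (idm N) r' r &
      forall N0 H (h : hom H G') (q : chain c H N0) (g : hom N0 N),
        head_zero (d' \oc h) q -> chain_mor (u \oc h) g q r ->
        chain_mor h g q r'].
Proof.
move=> ex H1 H2 H3.
have I W (v v' : hom W G') : u \oc v = u \oc v' -> d' \oc v = d' \oc v' ->
    v = v'.
  move=> e e'; apply/eqP; rewrite -subr_eq0; apply/eqP/H2.
    by rewrite compBr e subrr.
  by rewrite compBr e' subrr.
have E G1 (d1 : hom G1 G) (d1' : hom G1 G') : exact d1 d ->
    u \oc d1' = d1 -> d' \oc d1' = 0 -> exact d1' d'.
  move=> ex1 e1 e2; apply: chase_exact => // W v /[dup] dv /H3.
  case/(exact_chase ex1)=> W' [e [t [ee et]]]; exists W', e, t; split=> //.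
  apply: I; first by rewrite compA e1 et compA.
  by rewrite !compA e2 dv !comp0m.
case: c r ex => [|c] r /= [exd ex].
  have [r' [e1 e2]] := H1 _ _ (exact0 exd).
  exists r'; split.
  - split; first exact: E e1 e2.
    by apply: (@mono_of_comp A _ _ _ u); rewrite e1.
  - by rewrite compm1 e1.
  move=> N0 H h q g hz e; apply: I; first by rewrite !compA e1 e.
  by rewrite !compA e2 comp0m hz.
case: r exd ex => G1 [d1 r1] /= exd ex.
have [d1' [e1 e2]] := H1 _ _ (exact0 exd).
exists (existT _ G1 (d1', r1)); split=> /=.
- split; first exact: E e1 e2.
  apply: exact_from_ker ex => W v; rewrite -e1 -compA; split=> [e|->].
    apply: I; rewrite ?e ?compm0 //.
    by rewrite compA e2 comp0m.
  exact: compm0.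
- exists (idm G1); rewrite compm1; split=> //; exact: chain_mor_id.
move=> N0 H h q g hz [h1 [e m]]; exists h1; split=> //.
apply: I; first by rewrite !compA e1 e.
by rewrite !compA e2 comp0m hz.
Qed.

Lemma pull_chain c M N M' (f : hom M' M) (s : chain c.+1 M N) :
  exact_seq s ->
  exists p : chain c.+1 M' N,
    [/\ exact_seq p, chain_mor f (idm N) p s &
      forall M0 N0 (f0 : hom M0 M') (g : hom N0 N) (t : chain c.+1 M0 N0),
        exact_seq t -> chain_mor (f \oc f0) g t s -> chain_mor f0 g t p].
Proof.
case: s => G [d r] /= [/exact_epi ed ex].
have [G' [u [d' pb]]] := pullback_ex d f.
have [|||r' [ex' m' U]] := chain_lift (d' := d') (u := u) ex.
- move=> W v dv; apply: (pullback_lift pb); by rewrite dv compm0.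
- by move=> W v e1 e2; apply: (pullback_ext pb); rewrite ?e1 ?e2 compm0.
- by move=> W v e; rewrite compA pb.1 -compA e compm0.
exists (existT _ G' (d', r')); split=> /=.
- split=> //; apply/exact_epi; exact: pullback_epi pb ed.
- by exists u; split=> //; rewrite pb.1.
move=> M0 N0 f0 g [H [e q]] /= [/exact_epi ee exq] [h [eh mh]].
have [|h' [e1 e2]] := pullback_lift (u := h) (v := f0 \oc e) pb.
  by rewrite eh compA.
exists h'; split=> //; apply: U; last by rewrite e1.
have := exact_from_head exq; rewrite e2.
by case: (c) (q) => [|c'] q' /=; rewrite -compA => ->; rewrite compm0.
Qed.

Lemma push_chain_from c M N N' Y (g : hom N N') (d0 : hom M Y)
    (s : chain c.+1 M N) :
  exact_from d0 s ->
  exists p : chain c.+1 M N',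
    [/\ exact_from d0 p, chain_mor (idm M) g s p &
      forall M1 N1 (f : hom M M1) (g' : hom N' N1) (t : chain c.+1 M1 N1),
        head_zero (0 : hom M1 M1) t ->
        (forall Y1 (e : hom M1 Y1), exact_from e t ->
         chain_mor f (g' \oc g) s t -> chain_mor f g' p t)].
Proof.
elim: c M Y d0 s => [|c IH] M Y d0 [G [d r]] /= [exd ex].
  case: ex => ex mr.
  have [G' [u [i po]]] := pushout_ex r g.
  have [|d' [e1 e2]] := pushout_desc (u := d) (v := 0) po.
    by rewrite (exact0 ex) comp0m.
  exists (existT _ G' (d', i)); split=> /=.
  - have mi := pushout_mono po mr; split.
      apply: chase_exact.
        by apply: (pushout_ext po); rewrite -compA ?e1 ?e2 ?compm0 ?comp0m //;
           apply: exact0.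
      move=> W v /(exact_chase exd)[W' [e [t [ee et]]]].
      by exists W', e, (u \oc t); split; rewrite // compA e1.
    split=> //; apply: chase_exact => // W v dv.
    (* G (+) N' -> G' is an epimorphism *)
    pose k := bcopair u i.
    have ek : is_epi k.
      move=> Z a b e; apply: (pushout_ext po).
        by rewrite -(bcopair_in1 u i) !compA e.
      by rewrite -(bcopair_in2 u i) !compA e.
    have [W' [e [t [ee et]]]] := epi_chase v ek.
    have [|W2 [e' [t' [ee' et']]]] := exact_chase (u := pr1 _ _ \oc t) ex.
      have : d' \oc (v \oc e) = 0 by rewrite compA dv comp0m.
      by rewrite -et /k !compA comp_copair e1 e2 /bcopair comp0m addr0.
    exists W2, (e \oc e'), (g \oc t' + pr2 _ _ \oc t \oc e').
    split; first exact: epi_comp.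
    rewrite compA -et /k compDl compDr !compA -po.1 -(compA u r).
    by rewrite et' !compDl !compA.
  - by exists u; rewrite comp1m e1 po.1.
  move=> M1 N1 f g' [H [e q]] /= _ Y1 e0 [_ [exq _]] [h [eh mh]].
  have [|h' [a b]] := pushout_desc (u := h) (v := q \oc g') po.
    by rewrite -mh compA.
  exists h'; split=> //; apply: (pushout_ext po); rewrite -!compA.
    by rewrite a e1.
  by rewrite b e2 compm0 compA (exact0 exq) comp0m.
have [p [exp mp U]] := IH _ _ d r ex.
exists (existT _ G (d, p)); split=> //=.
  by exists (idm G); rewrite comp1m compm1.
move=> M1 N1 f g' [H [e q]] /= _ Y1 e0 [_ exq] [h [eh mh]].
exists h; split=> //; apply: U exq mh; exact: comp0m.
Qed.

Lemma push_chain c M N N' (g : hom N N') (s : chain c.+1 M N) :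
  exact_seq s ->
  exists p : chain c.+1 M N',
    [/\ exact_seq p, chain_mor (idm M) g s p &
      forall M1 N1 (f : hom M M1) (g' : hom N' N1) (t : chain c.+1 M1 N1),
        exact_seq t -> chain_mor f (g' \oc g) s t -> chain_mor f g' p t].
Proof.
move=> /(push_chain_from g)[p [ex m U]]; exists p; split=> //.
by move=> M1 N1 f g' t ext; apply: U ext; apply: comp0m.
Qed.

Lemma exact_chain_ex c M N : exists s : chain c.+1 M N, exact_seq s.
Proof.
elim: c M => [|c IH] M.
  exists (existT _ (bip M N) (pr1 M N, in2 M N)) => /=; split; last split.
  - apply/exact_epi/(@epi_of_comp _ _ _ _ _ (in1 M N)).
    rewrite pr1in1; exact: epi_id.
  - apply: chase_exact => [|W u e]; first exact: pr1in2.
    exists W, (idm W), (pr2 M N \oc u); split; first exact: epi_id.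
    rewrite compm1; apply: bip_ext; rewrite ?e !compA ?pr1in2 ?comp0m //.
    by rewrite pr2in2 comp1m.
  - apply: (@mono_of_comp _ _ _ _ (pr2 M N)); rewrite pr2in2; exact: mono_id.
have [[G [d r]] /= [exd ex]] := IH zob.
exists (existT _ M (idm M, existT _ G (0, r))) => /=; split; last split.
- by apply/exact_epi; apply: epi_id.
- apply: chase_exact => [|W u]; first by rewrite compm0.
  rewrite comp1m => ->; exists W, (idm W), 0; split; first exact: epi_id.
  by rewrite !compm0 comp0m.
apply: exact_from_ker ex => W v; split=> _; first exact: comp0m.
exact: to_zob.
Qed.

Definition bipm X Y X' Y' (f : hom X X') (g : hom Y Y') :
  hom (bip X Y) (bip X' Y') := bpair (f \oc pr1 X Y) (g \oc pr2 X Y).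

Lemma pr1_bipm X Y X' Y' (f : hom X X') (g : hom Y Y') :
  pr1 X' Y' \oc bipm f g = f \oc pr1 X Y.
Proof. exact: pr1_bpair. Qed.

Lemma pr2_bipm X Y X' Y' (f : hom X X') (g : hom Y Y') :
  pr2 X' Y' \oc bipm f g = g \oc pr2 X Y.
Proof. exact: pr2_bpair. Qed.

Lemma bipm_comp X Y X' Y' X'' Y'' (f : hom X X') (g : hom Y Y')
  (f' : hom X' X'') (g' : hom Y' Y'') :
  bipm f' g' \oc bipm f g = bipm (f' \oc f) (g' \oc g).
Proof.
apply: bip_ext.
  by rewrite compA !pr1_bipm -compA pr1_bipm compA.
by rewrite compA !pr2_bipm -compA pr2_bipm compA.
Qed.

Fixpoint chain_sum c X N X' N' :
    chain c X N -> chain c X' N' -> chain c (bip X X') (bip N N') :=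
  match c with
  | 0 => fun i i' => bipm i i'
  | c'.+1 => fun s s' =>
      existT _ (bip (projT1 s) (projT1 s'))
        (bipm (projT2 s).1 (projT2 s').1,
         chain_sum (projT2 s).2 (projT2 s').2)
  end.

Lemma bipm_exact X Y Z X' Y' Z' (f : hom X Y) (g : hom Y Z)
    (f' : hom X' Y') (g' : hom Y' Z') :
  exact f g -> exact f' g' -> exact (bipm f f') (bipm g g').
Proof.
move=> ex ex'; apply: chase_exact.
  rewrite bipm_comp (exact0 ex) (exact0 ex').
  by apply: bip_ext; rewrite ?pr1_bipm ?pr2_bipm comp0m compm0.
move=> W u e.
have [|W1 [e1 [v1 [ee1 ev1]]]] := exact_chase (u := pr1 _ _ \oc u) ex.
  by rewrite compA -(pr1_bipm g g') -compA e compm0.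
have [|W2 [e2 [v2 [ee2 ev2]]]] :=
    exact_chase (u := pr2 _ _ \oc u \oc e1) ex'.
  by rewrite !compA -(pr2_bipm g g') -(compA _ _ u) e compm0 comp0m.
exists W2, (e1 \oc e2), (bpair (v1 \oc e2) v2); split; first exact: epi_comp.
apply: bip_ext; rewrite !compA.
  by rewrite pr1_bipm -compA pr1_bpair compA ev1.
by rewrite pr2_bipm -compA pr2_bpair ev2.
Qed.

Lemma bipm_mono X Y X' Y' (f : hom X X') (g : hom Y Y') :
  is_mono f -> is_mono g -> is_mono (bipm f g).
Proof.
move=> mf mg W u v e; apply: bip_ext.
  by apply: mf; rewrite !compA -(pr1_bipm f g) -!compA e.
by apply: mg; rewrite !compA -(pr2_bipm f g) -!compA e.
Qed.

Lemma chain_sum_exact_from c X N Y X' N' Y' (g : hom X Y) (g' : hom X' Y')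
    (s : chain c X N) (s' : chain c X' N') :
  exact_from g s -> exact_from g' s' ->
  exact_from (bipm g g') (chain_sum s s').
Proof.
elim: c X Y X' Y' g g' s s' => [|c IH] X Y X' Y' g g' /= s s' [e H] [e' H'].
  by split; [exact: bipm_exact | exact: bipm_mono].
by split; [exact: bipm_exact | exact: IH].
Qed.

Lemma chain_sum_exact c M N M' N' (s : chain c M N) (s' : chain c M' N') :
  exact_seq s -> exact_seq s' -> exact_seq (chain_sum s s').
Proof.
move=> ex ex'; have := chain_sum_exact_from ex ex'.
apply: exact_from_ker => W v; rewrite comp0m; split=> // _.
by apply: bip_ext; rewrite compA ?pr1_bipm ?pr2_bipm -compA comp0m compm0.
Qed.

Lemma chain_sum_mor c X N X' N' Y L Y' L' (f : hom X Y) (g : hom N L)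
    (f' : hom X' Y') (g' : hom N' L') (s : chain c X N) (t : chain c Y L)
    (s' : chain c X' N') (t' : chain c Y' L') :
  chain_mor f g s t -> chain_mor f' g' s' t' ->
  chain_mor (bipm f f') (bipm g g') (chain_sum s s') (chain_sum t t').
Proof.
elim: c X X' Y Y' f f' s t s' t' => [|c IH] X X' Y Y' f f' /= s t s' t'.
  by move=> e e'; rewrite !bipm_comp e e'.
move=> [h [e m]] [h' [e' m']]; exists (bipm h h').
by rewrite !bipm_comp e e'; split=> //; apply: IH.
Qed.

Lemma chain_sum_diag c X N (s : chain c X N) :
  chain_mor (bpair (idm X) (idm X)) (bpair (idm N) (idm N)) s (chain_sum s s).
Proof.
have E (Y Z : A) (f : hom Y Z) :
    bipm f f \oc bpair (idm Y) (idm Y) = bpair (idm Z) (idm Z) \oc f.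
  apply: bip_ext.
    by rewrite !compA pr1_bipm -compA !pr1_bpair compm1 comp1m.
  by rewrite !compA pr2_bipm -compA !pr2_bpair compm1 comp1m.
elim: c X s => [|c IH] X /= s; first exact: E.
by exists (bpair (idm _) (idm _)); split.
Qed.

Definition bip_swap X Y : hom (bip X Y) (bip Y X) := bpair (pr2 X Y) (pr1 X Y).

Lemma chain_sum_swap c X N X' N' (s : chain c X N) (s' : chain c X' N') :
  chain_mor (bip_swap X X') (bip_swap N N') (chain_sum s s') (chain_sum s' s).
Proof.
have E (Y Z Y' Z' : A) (f : hom Y Z) (f' : hom Y' Z') :
    bipm f' f \oc bip_swap Y Y' = bip_swap Z Z' \oc bipm f f'.
  apply: bip_ext.
    by rewrite !compA pr1_bipm -compA !pr1_bpair pr2_bipm.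
  by rewrite !compA pr2_bipm -compA !pr2_bpair pr1_bipm.
elim: c X X' s s' => [|c IH] X X' /= s s'; first exact: E.
by exists (bip_swap _ _); split.
Qed.

Definition bip_assoc X Y Z : hom (bip (bip X Y) Z) (bip X (bip Y Z)) :=
  bpair (pr1 X Y \oc pr1 _ Z) (bipm (pr2 X Y) (idm Z)).

Lemma chain_sum_assoc c X N X' N' X'' N'' (s : chain c X N) (s' : chain c X' N')
    (s'' : chain c X'' N'') :
  chain_mor (bip_assoc X X' X'') (bip_assoc N N' N'')
    (chain_sum (chain_sum s s') s'') (chain_sum s (chain_sum s' s'')).
Proof.
have E (Y Z Y' Z' Y'' Z'' : A) (f : hom Y Z) (f' : hom Y' Z')
    (f'' : hom Y'' Z'') :
    bipm f (bipm f' f'') \oc bip_assoc Y Y' Y''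
    = bip_assoc Z Z' Z'' \oc bipm (bipm f f') f''.
  apply: bip_ext.
    rewrite !compA pr1_bipm -compA !pr1_bpair -[RHS]compA pr1_bipm.
    by rewrite !compA pr1_bipm.
  rewrite !compA pr2_bipm -compA !pr2_bpair !bipm_comp pr2_bipm.
  by rewrite compm1 comp1m.
elim: c X X' X'' s s' s'' => [|c IH] X X' X'' /= s s' s''; first exact: E.
by exists (bip_assoc _ _ _); split.
Qed.

Lemma chain_mor_zero c X N X' N' (s : chain c X N) (s' : chain c X' N') :
  chain_mor 0 0 s s'.
Proof.
elim: c X X' s s' => [|c IH] X X' /= s s'; first by rewrite comp0m compm0.
by exists 0; rewrite compm0 comp0m; split.
Qed.

End ExactChains.

(* Yext c M N is Ext^(c.+1)(M, N). *)
Section YExt.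
Variable A : abelian.
Implicit Types X Y M N G : A.

Definition eseq c M N := {s : chain c.+1 M N | exact_seq s}.

Definition eseq_step c M N (s t : eseq c M N) : Prop :=
  chain_mor (idm M) (idm N) (sval s) (sval t).

Definition eseq_rel c M N := clos_refl_sym_trans (eseq c M N) (@eseq_step c M N).

Lemma eseq_relP c M N : equivalence (@eseq_rel c M N).
Proof.
split; [exact: rst_refl | by move=> x y; apply: rst_sym |].
by move=> x y z; apply: rst_trans.
Qed.

Definition Yext c M N := quot (@eseq_rel c M N).
HB.instance Definition _ c M N := Choice.on (Yext c M N).

Definition ycls c M N (s : eseq c M N) : Yext c M N := cls (@eseq_rel c M N) s.

Lemma ycls_step c M N (s t : eseq c M N) :
  chain_mor (idm M) (idm N) (sval s) (sval t) -> ycls s = ycls t.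
Proof. by move=> m; apply/(cls_eqP (@eseq_relP c M N)); apply: rst_step. Qed.

Lemma ycls_ind c M N (P : Yext c M N -> Prop) :
  (forall s, P (ycls s)) -> forall a, P a.
Proof. exact: cls_ind. Qed.

Lemma yext_lift c M N T (f : eseq c M N -> T) :
  (forall s t, eseq_step s t -> f s = f t) ->
  forall s, f (repr (ycls s)) = f s.
Proof.
move=> H s; have := repr_rel (@eseq_relP c M N) s; rewrite -/(ycls s).
by move: (repr _) => t; elim=> [x y /H|x|x y _ ->|x y z _ -> _ ->].
Qed.

Definition pull_rep c M N M' (f : hom M' M) (s : eseq c M N) : eseq c M' N :=
  let p := cid (pull_chain f (proj2_sig s)) in
  exist _ (sval p) (let: And3 e _ _ := proj2_sig p in e).

Definition push_rep c M N N' (g : hom N N') (s : eseq c M N) : eseq c M N' :=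
  let p := cid (push_chain g (proj2_sig s)) in
  exist _ (sval p) (let: And3 e _ _ := proj2_sig p in e).

Definition ypull c M N M' (f : hom M' M) (a : Yext c M N) : Yext c M' N :=
  ycls (pull_rep f (repr a)).

Definition ypush c M N N' (g : hom N N') (a : Yext c M N) : Yext c M N' :=
  ycls (push_rep g (repr a)).

Lemma pull_repP c M N M' (f : hom M' M) (s : eseq c M N) :
  chain_mor f (idm N) (sval (pull_rep f s)) (sval s).
Proof. by rewrite /pull_rep; case: (cid _) => p [] /=. Qed.

Lemma pull_rep_univ c M N M' (f : hom M' M) (s : eseq c M N) M0 N0
    (f0 : hom M0 M') (g : hom N0 N) (t : eseq c M0 N0) :
  chain_mor (f \oc f0) g (sval t) (sval s) ->
  chain_mor f0 g (sval t) (sval (pull_rep f s)).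
Proof.
by rewrite /pull_rep; case: (cid _) => p [] /= _ _; apply; apply: (proj2_sig t).
Qed.

Lemma push_repP c M N N' (g : hom N N') (s : eseq c M N) :
  chain_mor (idm M) g (sval s) (sval (push_rep g s)).
Proof. by rewrite /push_rep; case: (cid _) => p [] /=. Qed.

Lemma push_rep_univ c M N N' (g : hom N N') (s : eseq c M N) M1 N1
    (f : hom M M1) (g' : hom N' N1) (t : eseq c M1 N1) :
  chain_mor f (g' \oc g) (sval s) (sval t) ->
  chain_mor f g' (sval (push_rep g s)) (sval t).
Proof.
by rewrite /push_rep; case: (cid _) => p [] /= _ _; apply; apply: (proj2_sig t).
Qed.

Lemma ypull_cls c M N M' (f : hom M' M) (s : eseq c M N) :
  ypull f (ycls s) = ycls (pull_rep f s).
Proof.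
apply: (yext_lift (f := fun s => ycls (pull_rep f s))) => {}s t m.
apply/ycls_step/pull_rep_univ; rewrite compm1.
by have := chain_mor_comp (pull_repP f s) m; rewrite comp1m compm1.
Qed.

Lemma ypush_cls c M N N' (g : hom N N') (s : eseq c M N) :
  ypush g (ycls s) = ycls (push_rep g s).
Proof.
apply: (yext_lift (f := fun s => ycls (push_rep g s))) => {}s t m.
apply/ycls_step/push_rep_univ; rewrite comp1m.
by have := chain_mor_comp m (push_repP g t); rewrite comp1m compm1.
Qed.

Lemma ypullE c M N M' (f : hom M' M) (p : eseq c M' N) (s : eseq c M N) :
  chain_mor f (idm N) (sval p) (sval s) -> ypull f (ycls s) = ycls p.
Proof.
move=> m; rewrite ypull_cls; apply/esym/ycls_step/pull_rep_univ.
by rewrite compm1.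
Qed.

Lemma ypushE c M N N' (g : hom N N') (s : eseq c M N) (p : eseq c M N') :
  chain_mor (idm M) g (sval s) (sval p) -> ypush g (ycls s) = ycls p.
Proof.
move=> m; rewrite ypush_cls; apply/ycls_step/push_rep_univ.
by rewrite comp1m.
Qed.

Lemma ypushpullE c M N M' N' (f : hom M M') (g : hom N N') (s : eseq c M N)
    (t : eseq c M' N') :
  chain_mor f g (sval s) (sval t) -> ypush g (ycls s) = ypull f (ycls t).
Proof.
move=> m; rewrite ypush_cls; apply/esym/ypullE/push_rep_univ.
by rewrite comp1m.
Qed.

Lemma ypull1 c M N (a : Yext c M N) : ypull (idm M) a = a.
Proof. by elim/ycls_ind: a => s; apply/ypullE/chain_mor_id. Qed.

Lemma ypush1 c M N (a : Yext c M N) : ypush (idm N) a = a.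
Proof. by elim/ycls_ind: a => s; apply/ypushE/chain_mor_id. Qed.

Lemma ypull_comp c M N M' M'' (f : hom M' M) (f' : hom M'' M')
    (a : Yext c M N) : ypull f' (ypull f a) = ypull (f \oc f') a.
Proof.
elim/ycls_ind: a => s; rewrite ypull_cls [LHS]ypull_cls; apply/esym/ypullE.
have := chain_mor_comp (pull_repP f' (pull_rep f s)) (pull_repP f s).
by rewrite comp1m.
Qed.

Lemma ypush_comp c M N N' N'' (g : hom N N') (g' : hom N' N'')
    (a : Yext c M N) : ypush g' (ypush g a) = ypush (g' \oc g) a.
Proof.
elim/ycls_ind: a => s; rewrite ypush_cls [LHS]ypush_cls; apply/esym/ypushE.
have := chain_mor_comp (push_repP g s) (push_repP g' (push_rep g s)).
by rewrite comp1m.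
Qed.

Lemma ypull_push c M N M' N' (f : hom M' M) (g : hom N N') (a : Yext c M N) :
  ypull f (ypush g a) = ypush g (ypull f a).
Proof.
elim/ycls_ind: a => s; rewrite (ypush_cls g s) (ypull_cls f s); symmetry; apply: ypushpullE.
have := chain_mor_comp (pull_repP f s) (push_repP g s).
by rewrite comp1m compm1.
Qed.

Definition eseq_sum c M N M' N' (s : eseq c M N) (s' : eseq c M' N') :
    eseq c (bip M M') (bip N N') :=
  exist _ (chain_sum (sval s) (sval s'))
    (chain_sum_exact (proj2_sig s) (proj2_sig s')).

Definition ysum c M N M' N' (a : Yext c M N) (a' : Yext c M' N') :
    Yext c (bip M M') (bip N N') :=
  ycls (eseq_sum (repr a) (repr a')).

Lemma bipm_pair W X Y X' Y' (f : hom X X') (g : hom Y Y') (h : hom W X)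
  (k : hom W Y) : bipm f g \oc bpair h k = bpair (f \oc h) (g \oc k).
Proof. by rewrite pair_comp -!compA pr1_bpair pr2_bpair. Qed.

Lemma bipm1 X Y : bipm (idm X) (idm Y) = idm (bip X Y).
Proof.
by apply: bip_ext; rewrite ?pr1_bipm ?pr2_bipm comp1m compm1.
Qed.

Lemma ysumE c M N M' N' (s : eseq c M N) (s' : eseq c M' N') :
  ysum (ycls s) (ycls s') = ycls (eseq_sum s s').
Proof.
rewrite /ysum.
rewrite (yext_lift (f := fun s => ycls (eseq_sum s (repr (ycls s'))))).
  apply: (yext_lift (f := fun s' => ycls (eseq_sum s s'))) => t t' m.
  apply/ycls_step; rewrite -!bipm1; apply: chain_sum_mor => //.
  exact: chain_mor_id.
move=> t t' m; apply/ycls_step; rewrite -!bipm1; apply: chain_sum_mor => //.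
exact: chain_mor_id.
Qed.

Lemma ysum_pull c M N M' N' L L' (f : hom L M) (f' : hom L' M')
    (a : Yext c M N) (a' : Yext c M' N') :
  ysum (ypull f a) (ypull f' a') = ypull (bipm f f') (ysum a a').
Proof.
elim/ycls_ind: a => s; elim/ycls_ind: a' => s'; rewrite (ysumE s s').
rewrite (ypull_cls f s) (ypull_cls f' s') ysumE; symmetry; apply: ypullE; rewrite -bipm1; apply: chain_sum_mor; exact: pull_repP.
Qed.

Lemma ysum_push c M N M' N' L L' (g : hom N L) (g' : hom N' L')
    (a : Yext c M N) (a' : Yext c M' N') :
  ysum (ypush g a) (ypush g' a') = ypush (bipm g g') (ysum a a').
Proof.
elim/ycls_ind: a => s; elim/ycls_ind: a' => s'; rewrite (ysumE s s').
rewrite (ypush_cls g s) (ypush_cls g' s') ysumE; symmetry; apply: ypushE; rewrite -bipm1; apply: chain_sum_mor; exact: push_repP.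
Qed.

Definition diag X : hom X (bip X X) := bpair (idm X) (idm X).
Definition codiag X : hom (bip X X) X := bcopair (idm X) (idm X).

Definition yadd c M N (a b : Yext c M N) : Yext c M N :=
  ypull (diag M) (ypush (codiag N) (ysum a b)).

Lemma bipm_diag X Y (f : hom X Y) : bipm f f \oc diag X = diag Y \oc f.
Proof.
apply: bip_ext; rewrite compA ?pr1_bipm ?pr2_bipm -compA ?pr1_bpair ?pr2_bpair
  compA ?pr1_bpair ?pr2_bpair; by rewrite compm1 comp1m.
Qed.

Lemma codiag_bipm X Y (f : hom X Y) : codiag Y \oc bipm f f = f \oc codiag X.
Proof.
by rewrite /codiag /bipm bcopair_pair comp_copair /bcopair !comp1m compm1.
Qed.

Lemma ypullD c M N M' (f : hom M' M) (a b : Yext c M N) :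
  ypull f (yadd a b) = yadd (ypull f a) (ypull f b).
Proof.
rewrite /yadd ypull_comp ysum_pull -ypull_push ypull_comp.
by rewrite bipm_diag.
Qed.

Lemma ypushD c M N N' (g : hom N N') (a b : Yext c M N) :
  ypush g (yadd a b) = yadd (ypush g a) (ypush g b).
Proof.
by rewrite /yadd -ypull_push ypush_comp ysum_push ypush_comp codiag_bipm.
Qed.

Lemma yaddC c M N : commutative (@yadd c M N).
Proof.
move=> a b; elim/ycls_ind: a => s; elim/ycls_ind: b => t.
rewrite /yadd (ysumE s t) (ysumE t s).
have e := @ypushpullE _ _ _ _ _ _ _ (eseq_sum s t) (eseq_sum t s)
            (chain_sum_swap (sval s) (sval t)).
have e1 : bip_swap M M \oc diag M = diag M.
  by rewrite /bip_swap pair_comp pr1_bpair pr2_bpair.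
have e2 : codiag N \oc bip_swap N N = codiag N.
  by rewrite bcopair_pair !comp1m addrC /codiag /bcopair !comp1m.
by rewrite -[in RHS]e1 -ypull_comp (ypull_push (bip_swap M M)) -e ypush_comp e2.
Qed.

Lemma yaddA c M N : associative (@yadd c M N).
Proof.
move=> a b d; rewrite {1 3}/yadd.
have -> : ysum a (yadd b d) = ypull (bipm (idm M) (diag M))
    (ypush (bipm (idm N) (codiag N)) (ysum a (ysum b d))).
  by rewrite -ysum_push -ysum_pull ypull1 ypush1.
have -> : ysum (yadd a b) d = ypull (bipm (diag M) (idm M))
    (ypush (bipm (codiag N) (idm N)) (ysum (ysum a b) d)).
  by rewrite -ysum_push -ysum_pull ypull1 ypush1.
rewrite -!ypull_push !ypush_comp !ypull_comp.
elim/ycls_ind: a => s; elim/ycls_ind: b => t; elim/ycls_ind: d => u.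
rewrite (ysumE s t) (ysumE t u) (ysumE (eseq_sum s t) u)
  (ysumE s (eseq_sum t u)).
have e := @ypushpullE _ _ _ _ _ _ _ (eseq_sum (eseq_sum s t) u)
  (eseq_sum s (eseq_sum t u)) (chain_sum_assoc (sval s) (sval t) (sval u)).
have <- : bip_assoc M M M \oc (bipm (diag M) (idm M) \oc diag M)
          = bipm (idm M) (diag M) \oc diag M.
  rewrite (bipm_pair (diag M) (idm M) (idm M)).
  rewrite (bipm_pair (idm M) (diag M) (idm M)) !compm1.
  rewrite pair_comp -compA pr1_bpair (pr1_bpair (idm M)) bipm_pair.
  by rewrite (pr2_bpair (idm M)) comp1m.
have <- : codiag N \oc bipm (idm N) (codiag N) \oc bip_assoc N N N
          = codiag N \oc bipm (codiag N) (idm N).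
  rewrite -compA bipm_pair /codiag /bipm !bcopair_pair !comp1m.
  by rewrite /bcopair !comp1m compDl addrA.
by rewrite -[in RHS]ypush_comp e -[in RHS]ypull_push ypull_comp.
Qed.

Lemma ypush_addm c M N N' (f g : hom N N') (a : Yext c M N) :
  ypush (f + g) a = yadd (ypush f a) (ypush g a).
Proof.
rewrite /yadd ysum_push ypush_comp ypull_push.
have -> : ypull (diag M) (ysum a a) = ypush (diag N) a.
  elim/ycls_ind: a => s; rewrite ysumE; symmetry; apply: ypushpullE.
  exact: chain_sum_diag.
rewrite ypush_comp -compA bipm_pair bcopair_pair.
by rewrite !comp1m !compm1.
Qed.

Lemma ypush0_pull0 c M N M' N' (a : Yext c M N) (b : Yext c M' N') :
  ypush 0 a = ypull 0 b.
Proof.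
elim/ycls_ind: a => s; elim/ycls_ind: b => t.
exact/ypushpullE/chain_mor_zero.
Qed.

Lemma yext_inh c M N : {a : Yext c M N | True}.
Proof.
by apply: cid; have [s ex] := exact_chain_ex c M N; exists (ycls (exist _ s ex)).
Qed.

Definition yzero c M N : Yext c M N := ypush 0 (sval (yext_inh c M N)).
Definition yopp c M N (a : Yext c M N) : Yext c M N := ypush (- idm N) a.

Lemma ypush0 c M N N' (a : Yext c M N) : ypush (0 : hom N N') a = yzero c M N'.
Proof.
by rewrite (ypush0_pull0 a (yzero c M N')) /yzero; symmetry; apply: ypush0_pull0.
Qed.

Lemma yadd0 c M N : left_id (yzero c M N) (@yadd c M N).
Proof.
by move=> a; rewrite -[in LHS](ypush1 a) -(ypush0 N a) -ypush_addm add0r ypush1.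
Qed.

Lemma yaddN c M N : left_inverse (yzero c M N) (@yopp c M N) (@yadd c M N).
Proof.
by move=> a; rewrite -[X in yadd _ X](ypush1 a) /yopp -ypush_addm addNr ypush0.
Qed.

HB.instance Definition _ c M N := GRing.isZmodule.Build (Yext c M N)
  (@yaddA c M N) (@yaddC c M N) (@yadd0 c M N) (@yaddN c M N).

Definition Ext (c : nat) (M N : A) : zmodType :=
  match c with
  | 0 => hom M N
  | c'.+1 => Yext c' M N
  end.

Definition epull c M N M' (f : hom M' M) : Ext c M N -> Ext c M' N :=
  match c with
  | 0 => fun a => a \oc f
  | c'.+1 => @ypull c' M N M' f
  end.

Definition epush c M N N' (g : hom N N') : Ext c M N -> Ext c M N' :=
  match c with
  | 0 => fun a => g \oc a
  | c'.+1 => @ypush c' M N N' g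
  end.

Lemma epull1 c M N (a : Ext c M N) : epull (idm M) a = a.
Proof. by case: c a => [|c] a /=; [exact: compm1 | exact: ypull1]. Qed.

Lemma epush1 c M N (a : Ext c M N) : epush (idm N) a = a.
Proof. by case: c a => [|c] a /=; [exact: comp1m | exact: ypush1]. Qed.

Lemma epull_comp c M N M' M'' (f : hom M' M) (f' : hom M'' M')
    (a : Ext c M N) : epull f' (epull f a) = epull (f \oc f') a.
Proof. by case: c a => [|c] a /=; [rewrite compA | exact: ypull_comp]. Qed.

Lemma epush_comp c M N N' N'' (g : hom N N') (g' : hom N' N'')
    (a : Ext c M N) : epush g' (epush g a) = epush (g' \oc g) a.
Proof. by case: c a => [|c] a /=; [rewrite compA | exact: ypush_comp]. Qed.

Lemma epull_push c M N M' N' (f : hom M' M) (g : hom N N') (a : Ext c M N) :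
  epull f (epush g a) = epush g (epull f a).
Proof. by case: c a => [|c] a /=; [rewrite compA | exact: ypull_push]. Qed.

Lemma epullD c M N M' (f : hom M' M) (a b : Ext c M N) :
  epull f (a + b) = epull f a + epull f b.
Proof. by case: c a b => [|c] a b /=; [exact: compDl | exact: ypullD]. Qed.

Lemma epushD c M N N' (g : hom N N') (a b : Ext c M N) :
  epush g (a + b) = epush g a + epush g b.
Proof. by case: c a b => [|c] a b /=; [exact: compDr | exact: ypushD]. Qed.

End YExt.

Record functor (A B : preadd) := Functor {
  fob :> A -> B;
  fhom : forall x y, hom x y -> hom (fob x) (fob y);
  fhom1 : forall x, fhom (idm x) = idm (fob x);
  fhom_comp : forall x y z (g : hom y z) (f : hom x y),
    fhom (g \oc f) = fhom g \oc fhom f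
}.

Definition additive_functor (A B : preadd) (F : functor A B) : Prop :=
  forall x y (f g : hom x y), fhom F (f + g) = fhom F f + fhom F g.

Definition exact_functor (A B : preadd) (F : functor A B) : Prop :=
  additive_functor F /\
  forall x y z (i : hom x y) (p : hom y z),
    short_exact i p -> short_exact (fhom F i) (fhom F p).

Definition right_adjoint (A B : preadd) (F : functor A B) (G : functor B A) :
    Prop :=
  exists phi : forall (x : A) (y : B), hom (F x) y -> hom x (G y),
    (forall x y, bijective (@phi x y)) /\
    (forall x' x y y' (f : hom x' x) (g : hom y y') (h : hom (F x) y),
       phi x' y' (g \oc h \oc fhom F f) = fhom G g \oc phi x y h \oc f).

Section ExactFunctor.
Variables (A B : abelian) (F : functor A B).
Hypothesis exF : exact_functor F.

Fixpoint chain_map c (X N : A) : chain c X N -> chain c (F X) (F N) :=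
  match c with
  | 0 => fun i => fhom F i
  | c'.+1 => fun s => existT _ (F (projT1 s))
      (fhom F (projT2 s).1, chain_map (projT2 s).2)
  end.

Lemma chain_map_mor c (X N X' N' : A) (f : hom X X') (g : hom N N')
    (s : chain c X N) (t : chain c X' N') :
  chain_mor f g s t ->
  chain_mor (fhom F f) (fhom F g) (chain_map s) (chain_map t).
Proof.
elim: c X X' f s t => [|c IH] X X' f /= s t.
  by move=> e; rewrite -!fhom_comp e.
move=> [h [e m]]; exists (fhom F h); rewrite -!fhom_comp e; split=> //.
exact: IH.
Qed.

Lemma exact_functor0 (x y : A) : fhom F (0 : hom x y) = 0.
Proof.
by apply: (@addrI _ (fhom F 0)); rewrite -exF.1 !addr0.
Qed.

Lemma mono_short_exact (x y : A) (i : hom x y) :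
  is_mono i -> short_exact i (cokerm i).
Proof.
by move=> mi; split; [| exact: cokerm_epi | exact/cokernel_exact/cokerP].
Qed.

Lemma epi_short_exact (x y : A) (p : hom x y) :
  is_epi p -> short_exact (kerm p) p.
Proof.
by move=> ep; split; [exact: kerm_mono | | exact/kernel_exact/kerP].
Qed.

Lemma exact_functor_mono (x y : A) (i : hom x y) :
  is_mono i -> is_mono (fhom F i).
Proof. by move=> /mono_short_exact /(proj2 exF) []. Qed.

Lemma exact_functor_epi (x y : A) (i : hom x y) :
  is_epi i -> is_epi (fhom F i).
Proof. by move=> /epi_short_exact /(proj2 exF) []. Qed.

Lemma exact_functor_exact (x y z : A) (f : hom x y) (g : hom y z) :
  exact f g -> exact (fhom F f) (fhom F g).
Proof.
case=> k [i [e [ki ee ->]]].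
have mi := kernel_mono ki.
have [_ eq exq] := proj2 exF _ _ _ _ _ (mono_short_exact mi).
have kF := exact_kernel (exact_functor_mono mi) exq.
have [|m em] := cokernel_desc (u := g) (cokerP i); first by case: ki.
have mm : is_mono m.
  apply: monoP => w u mu.
  have [w' [e' [v [ee' ev]]]] := epi_chase u (cokerm_epi (f := i)).
  have [|v' ev'] := kernel_lift (u := v) ki.
    by rewrite -em -compA ev compA mu comp0m.
  by apply: (epi0 ee'); rewrite -ev -ev' compA comp_cokerm comp0m.
exists (F k), (fhom F i), (fhom F e); split.
- apply: mk_kernel; last 1 first.
  + move=> w u; rewrite -em fhom_comp -compA => /mono0 gu.
    by apply: (kernel_lift kF); apply/gu/exact_functor_mono.
  + by rewrite -fhom_comp ki.1 exact_functor0.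
  + exact: exact_functor_mono.
- exact: exact_functor_epi.
- exact: fhom_comp.
Qed.

Lemma chain_map_exact_from c (X N Y : A) (g : hom X Y) (s : chain c X N) :
  exact_from g s -> exact_from (fhom F g) (chain_map s).
Proof.
elim: c X Y g s => [|c IH] X Y g /= s [/exact_functor_exact e H].
  by split=> //; apply: exact_functor_mono.
by split=> //; apply: IH.
Qed.

Lemma chain_map_exact c (M N : A) (s : chain c M N) :
  exact_seq s -> exact_seq (chain_map s).
Proof.
move=> /chain_map_exact_from; apply: exact_from_ker => W v.
by rewrite exact_functor0 !comp0m.
Qed.

Definition eseq_map c (M N : A) (s : eseq c M N) : eseq c (F M) (F N) :=
  exist _ (chain_map (sval s)) (chain_map_exact (proj2_sig s)).

(* The map on Ext that applies an exact functor to representatives. *)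
Definition ext_map c (M N : A) : Ext c M N -> Ext c (F M) (F N) :=
  match c with
  | 0 => @fhom _ _ F M N
  | c'.+1 => fun a : Yext c' M N => ycls (eseq_map (repr a))
  end.

Lemma ext_mapE c (M N : A) (s : eseq c M N) :
  @ext_map c.+1 M N (ycls s) = ycls (eseq_map s).
Proof.
apply: (yext_lift (f := fun s => ycls (eseq_map s))) => {}s t m.
by apply: ycls_step; rewrite -!fhom1; apply: chain_map_mor.
Qed.

Lemma ext_map_pull c (M N M' : A) (f : hom M' M) (a : Ext c M N) :
  ext_map (epull f a) = epull (fhom F f) (ext_map a).
Proof.
case: c a => [|c] a; first exact: fhom_comp.
elim/ycls_ind: a => s; rewrite [epull f _](ypull_cls f s) !ext_mapE.
symmetry; apply: ypullE; rewrite -fhom1; apply: chain_map_mor.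
exact: pull_repP.
Qed.

Lemma ext_map_push c (M N N' : A) (g : hom N N') (a : Ext c M N) :
  ext_map (epush g a) = epush (fhom F g) (ext_map a).
Proof.
case: c a => [|c] a; first exact: fhom_comp.
elim/ycls_ind: a => s; rewrite [epush g _](ypush_cls g s) !ext_mapE.
symmetry; apply: ypushE; rewrite -fhom1; apply: chain_map_mor.
exact: push_repP.
Qed.

End ExactFunctor.

Record is_thick (A : preadd) (C : A -> Prop) : Prop := IsThick {
  thick_inh : exists x, C x;
  thick_sub : forall x y (i : hom x y), is_mono i -> C y -> C x;
  thick_quo : forall x y (p : hom x y), is_epi p -> C x -> C y;
  thick_ext : forall x y z (i : hom x y) (p : hom y z),
    short_exact i p -> C x -> C z -> C y
}.

Lemma op_thick (A : abelian) (C : A -> Prop) :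
  is_thick C -> @is_thick (op A) C.
Proof.
case=> inh sub quo ext; split=> //.
- by move=> x y i ei; apply: (quo y x i).
- by move=> x y p mp; apply: (sub y x p).
move=> x y z i p [mi ep ex] Cx Cz; apply: (ext z y x p i) => //; split=> //.
by have := exact_kernel mi ex => ki; apply: (@cokernel_exact A).
Qed.

Section Thick.
Variables (A : abelian) (C : A -> Prop).
Hypothesis thC : is_thick C.
Implicit Types x y z w : A.

Lemma thick_id0 x : idm x = 0 -> C x.
Proof.
move=> e; have [y Cy] := thick_inh thC.
apply: (thick_sub thC (i := (0 : hom x y))) => //; apply: monoP => w u _.
by rewrite -(comp1m u) e comp0m.
Qed.

Lemma thick_zob : C zob.
Proof. by apply: thick_id0; apply: to_zob. Qed.

Lemma thick_exact x y z (f : hom x y) (g : hom y z) :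
  exact f g -> C x -> C z -> C y.
Proof.
move=> ex Cx Cz; have [k [m [e [mm ee ge]]]] := image_ex g.
have [k' [i [e' [ki ee' fe]]]] := ex.
apply: (thick_ext thC (i := i) (p := e)).
- split=> //; first exact: kernel_mono ki.
  apply/kernel_exact; apply: mk_kernel.
  + by apply: (mono0 mm); rewrite compA -ge ki.1.
  + exact: kernel_mono ki.
  + move=> w u eu; apply: (kernel_lift ki); by rewrite ge -compA eu compm0.
- exact: thick_quo ee' Cx.
- exact: thick_sub mm Cz.
Qed.

Lemma thick_bip x y : C x -> C y -> C (bip x y).
Proof.
apply: (thick_exact (f := in1 x y) (g := pr2 x y)); apply: kernel_exact.
apply: mk_kernel.
- exact: pr2in1.
- by apply: (@mono_of_comp _ _ _ _ (pr1 x y)); rewrite pr1in1; apply: mono_id.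
move=> w u e; exists (pr1 x y \oc u); apply: bip_ext.
  by rewrite !compA pr1in1 comp1m.
by rewrite !compA pr2in1 !comp0m e.
Qed.

(* Morphisms whose kernel and cokernel lie in C. *)
Definition Ciso x y (f : hom x y) := C (ker f) /\ C (coker f).

Lemma Cker_mono x y (f : hom x y) : is_mono f -> C (ker f).
Proof.
move=> mf; apply: thick_id0; apply: (@kerm_mono _ _ _ f).
by rewrite compm1 compm0; apply: (mono0 mf); apply: comp_kerm.
Qed.

Lemma Ccoker_epi x y (f : hom x y) : is_epi f -> C (coker f).
Proof.
move=> ef; apply: thick_id0; apply: (@cokerm_epi _ _ _ f).
by rewrite comp1m comp0m; apply: (epi0 ef); apply: comp_cokerm.
Qed.

Lemma Cker_comp x y z (g : hom y z) (f : hom x y) :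
  C (ker g) -> C (ker f) -> C (ker (g \oc f)).
Proof.
move=> Cg Cf.
have [|a ea] := kernel_lift (u := kerm f) (kerP (g \oc f)).
  by rewrite -compA comp_kerm compm0.
have [|b eb] := kernel_lift (u := f \oc kerm (g \oc f)) (kerP g).
  by rewrite compA comp_kerm.
apply: (thick_exact (f := a) (g := b)) => //; apply: kernel_exact.
apply: mk_kernel.
- apply: (@kerm_mono _ _ _ g); rewrite compA eb -compA ea compm0.
  exact: comp_kerm.
- by apply: (@mono_of_comp _ _ _ _ (kerm (g \oc f))); rewrite ea; apply: kerm_mono.
move=> w u bu; have [|v ev] := kernel_lift (u := kerm (g \oc f) \oc u) (kerP f).
  by rewrite compA -eb -compA bu compm0.
by exists v; apply: (@kerm_mono _ _ _ (g \oc f)); rewrite compA ea.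
Qed.

Lemma Cker_of_comp x y z (g : hom y z) (f : hom x y) :
  C (ker (g \oc f)) -> C (ker f).
Proof.
have [|a ea] := kernel_lift (u := kerm f) (kerP (g \oc f)).
  by rewrite -compA comp_kerm compm0.
apply: (thick_sub thC (i := a)).
apply: (@mono_of_comp _ _ _ _ (kerm (g \oc f))); rewrite ea; exact: kerm_mono.
Qed.

Lemma Cker_kernel x y (f : hom x y) k (i : hom k x) :
  is_kernel f i -> C k <-> C (ker f).
Proof.
move=> ki; have [a ea] := kernel_lift (kerP f) ki.1.
have [b eb] := kernel_lift ki (comp_kerm f).
split; apply: (thick_sub thC).
  apply: (@mono_of_comp _ _ _ _ i b); rewrite eb; exact: kerm_mono.
by apply: (@mono_of_comp _ _ _ _ (kerm f) a); rewrite ea; apply: kernel_mono ki.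
Qed.

Lemma Cker_pull x y z (f : hom x z) (g : hom y z) p
    (p1 : hom p x) (p2 : hom p y) :
  is_pullback f g p1 p2 -> C (ker f) -> C (ker p2).
Proof.
move=> pb; have [|u eu] := kernel_lift (u := p1 \oc kerm p2) (kerP f).
  by rewrite compA pb.1 -compA comp_kerm compm0.
apply: (thick_sub thC (i := u)); apply: monoP => w v uv.
apply: (@kerm_mono _ _ _ p2); rewrite compm0; apply: (pullback_ext pb).
  by rewrite compA -eu -compA uv !compm0.
by rewrite compA comp_kerm comp0m compm0.
Qed.

Lemma Ccoker_pull x y z (f : hom x z) (g : hom y z) p
    (p1 : hom p x) (p2 : hom p y) :
  is_pullback f g p1 p2 -> C (coker f) -> C (coker p2).
Proof.
move=> pb.
have [|m em] := cokernel_desc (u := cokerm f \oc g) (cokerP p2).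
  by rewrite -compA -pb.1 compA comp_cokerm comp0m.
apply: (thick_sub thC (i := m)); apply: monoP => w u mu.
have [w' [e [v [ee ev]]]] := epi_chase u (cokerm_epi (f := p2)).
have [|w2 [e' [t [ee' et]]]] :=
    exact_chase (u := g \oc v) (cokernel_exact (cokerP f)).
  by rewrite compA -em -compA ev compA mu comp0m.
have [|h [h1 h2]] := pullback_lift (u := t) (v := v \oc e') pb.
  by rewrite et compA.
apply: (epi0 (epi_comp ee ee')).
by rewrite compA -ev -compA -h2 compA comp_cokerm comp0m.
Qed.

Lemma Ciso_pull x y z (f : hom x z) (g : hom y z) p
    (p1 : hom p x) (p2 : hom p y) :
  is_pullback f g p1 p2 -> Ciso f -> Ciso p2.
Proof.
by move=> pb [? ?]; split; [exact: Cker_pull pb _ | exact: Ccoker_pull pb _].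
Qed.

Lemma ker_to_C x y (f : hom x y) : C y -> Ciso (kerm f).
Proof.
move=> Cy; split; first by apply/Cker_mono/kerm_mono.
have [m em] := cokernel_desc (cokerP (kerm f)) (comp_kerm f).
apply: (thick_sub thC (i := m)) => //; apply: monoP => w u mu.
have [w' [e [v [ee ev]]]] := epi_chase u (cokerm_epi (f := kerm f)).
have [|t et] := kernel_lift (u := v) (kerP f).
  by rewrite -em -compA ev compA mu comp0m.
by apply: (epi0 ee); rewrite -ev -et compA comp_cokerm comp0m.
Qed.

End Thick.

Section ThickDual.
Variables (A : abelian) (C : A -> Prop).
Hypothesis thC : is_thick C.
Implicit Types x y z w : A.
Let thO := op_thick thC.

Lemma op_ker x y (f : hom x y) : C (@ker (op A) y x f) <-> C (coker f).
Proof. by apply: iff_sym; apply: (Cker_kernel thO (i := cokerm f)); apply: cokerP. Qed.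

Lemma op_coker x y (f : hom x y) : C (@coker (op A) y x f) <-> C (ker f).
Proof. apply: (Cker_kernel thC (f := f)); exact: (@cokerP (op A) y x f). Qed.

Lemma op_Ciso x y (f : hom x y) :
  @Ciso (op A) C y x f <-> Ciso C f.
Proof.
by split=> -[h1 h2]; split; [exact/op_coker|exact/op_ker|exact/op_ker|exact/op_coker].
Qed.

Lemma Ccoker_comp x y z (g : hom y z) (f : hom x y) :
  C (coker g) -> C (coker f) -> C (coker (g \oc f)).
Proof.
move=> /op_ker Cg /op_ker Cf; apply/op_ker; exact: (Cker_comp thO Cf Cg).
Qed.

Lemma Ccoker_of_comp x y z (g : hom y z) (f : hom x y) :
  C (coker (g \oc f)) -> C (coker g).
Proof. move=> /op_ker Cg; apply/op_ker; exact: (Cker_of_comp thO Cg). Qed.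

Lemma Ciso_push x y z (f : hom z x) (g : hom z y) p
    (i1 : hom x p) (i2 : hom y p) :
  is_pushout f g i1 i2 -> Ciso C f -> Ciso C i2.
Proof.
move=> po /op_Ciso H; apply/op_Ciso.
exact: (@Ciso_pull (op A) C thO x y z f g p i1 i2 po H).
Qed.

Lemma Ciso_id x : Ciso C (idm x).
Proof.
split; first by apply/(Cker_mono thC)/mono_id.
by apply/(Ccoker_epi thC)/epi_id.
Qed.

Lemma Ciso_comp x y z (g : hom y z) (f : hom x y) :
  Ciso C g -> Ciso C f -> Ciso C (g \oc f).
Proof.
by move=> [? ?] [? ?]; split; [exact: Cker_comp | exact: Ccoker_comp].
Qed.

Lemma coker_from_C x y (f : hom x y) : C x -> Ciso C (cokerm f).
Proof.
move=> Cx; split; last by apply/(Ccoker_epi thC)/cokerm_epi.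
have [k [m [e [mm ee fe]]]] := image_ex f.
apply/(Cker_kernel thC (i := m)); last exact: thick_quo ee Cx.
have cm : is_cokernel m (cokerm f).
  apply: mk_cokernel.
  - by apply: (epi0 ee); rewrite -compA -fe comp_cokerm.
  - exact: cokerm_epi.
  - by move=> w u um; apply: (cokernel_desc (cokerP f)); rewrite fe compA um comp0m.
exact: mono_kernel mm cm.
Qed.

End ThickDual.

Record thick (A : abelian) := Thick {
  thick_mem :> A -> Prop;
  thickP : is_thick thick_mem
}.

Section SerreHom.
Variables (A : abelian) (C : thick A).
Implicit Types M N L X Y : A.
Let thC := thickP C.

(* Subobjects M' <= M with M/M' in C. *)
Record csub (M : A) := Csub {
  cs_dom : A;
  cs_inc : hom cs_dom M;
  cs_mono : is_mono cs_inc;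
  cs_coker : C (coker cs_inc)
}.

(* Subobjects N' <= N with N' in C. *)
Record tsub (N : A) := Tsub {
  ts_dom : A;
  ts_inc : hom ts_dom N;
  ts_mono : is_mono ts_inc;
  ts_mem : C ts_dom
}.

(* csub is ordered by reverse inclusion, tsub by inclusion. *)
Definition cs_le M (i j : csub M) : Prop :=
  exists h : hom (cs_dom j) (cs_dom i), cs_inc i \oc h = cs_inc j.

Definition ts_le N (i j : tsub N) : Prop :=
  exists h : hom (ts_dom i) (ts_dom j), ts_inc j \oc h = ts_inc i.

Definition cs_res M (i j : csub M) (h : cs_le i j) :
  hom (cs_dom j) (cs_dom i) := sval (cid h).

Lemma cs_resP M (i j : csub M) (h : cs_le i j) :
  cs_inc i \oc cs_res h = cs_inc j.
Proof. exact: proj2_sig (cid h). Qed.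

Lemma cs_res_uniq M (i j : csub M) (h : cs_le i j) f :
  cs_inc i \oc f = cs_inc j -> f = cs_res h.
Proof. by rewrite -(cs_resP h); apply: cs_mono. Qed.

Definition ts_coker N (j : tsub N) : A := coker (ts_inc j).
Definition ts_proj N (j : tsub N) : hom N (ts_coker j) := cokerm (ts_inc j).

Lemma ts_proj_epi N (j : tsub N) : is_epi (ts_proj j).
Proof. exact: cokerm_epi. Qed.

Lemma ts_quo_ex N (i j : tsub N) (h : ts_le i j) :
  exists f : hom (ts_coker i) (ts_coker j), f \oc ts_proj i = ts_proj j.
Proof.
apply: (cokernel_desc (cokerP _)); case: h => f <-.
by rewrite compA comp_cokerm comp0m.
Qed.

Definition ts_quo N (i j : tsub N) (h : ts_le i j) :
  hom (ts_coker i) (ts_coker j) := sval (cid (ts_quo_ex h)).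

Lemma ts_quoP N (i j : tsub N) (h : ts_le i j) :
  ts_quo h \oc ts_proj i = ts_proj j.
Proof. exact: proj2_sig (cid (ts_quo_ex h)). Qed.

Lemma csub_full_coker M : C (coker (idm M)).
Proof. by apply/(Ccoker_epi thC)/epi_id. Qed.

Definition csub_full M : csub M := Csub (@mono_id A M) (@csub_full_coker M).

Lemma zob_mono N : is_mono (0 : hom (@zob A) N).
Proof. by apply: monoP => w u _; apply: to_zob. Qed.

Definition tsub_zero N : tsub N := Tsub (@zob_mono N) (thick_zob thC).

Lemma cs_le_refl M (i : csub M) : cs_le i i.
Proof. by exists (idm _); rewrite compm1. Qed.

Lemma cs_le_trans M (i j k : csub M) : cs_le i j -> cs_le j k -> cs_le i k.
Proof. by case=> f e [g e']; exists (f \oc g); rewrite compA e. Qed.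

Lemma ts_le_refl M (i : tsub M) : ts_le i i.
Proof. by exists (idm _); rewrite compm1. Qed.

Lemma ts_le_trans M (i j k : tsub M) : ts_le i j -> ts_le j k -> ts_le i k.
Proof. by case=> f e [g e']; exists (g \oc f); rewrite compA e'. Qed.

Lemma csub_Ciso M (i : csub M) : Ciso C (cs_inc i).
Proof. split; [exact/(Cker_mono thC)/cs_mono | exact: cs_coker]. Qed.

Lemma tsub_Ciso N (j : tsub N) : Ciso C (ts_proj j).
Proof. exact/(coker_from_C thC)/ts_mem. Qed.

Lemma cs_dir M (i j : csub M) : exists k, cs_le i k /\ cs_le j k.
Proof.
have [P [p1 [p2 pb]]] := pullback_ex (cs_inc i) (cs_inc j).
have m : is_mono (cs_inc j \oc p2).
  apply: mono_comp; first exact: cs_mono.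
  by apply: pullback_mono pb _; apply: cs_mono.
have [_ c] : Ciso C (cs_inc j \oc p2).
  apply: (Ciso_comp thC); first exact: csub_Ciso.
  by apply: (Ciso_pull thC pb); apply: csub_Ciso.
by exists (Csub m c); split; [exists p1; rewrite pb.1 | exists p2].
Qed.

Lemma ts_dir N (i j : tsub N) : exists k, ts_le i k /\ ts_le j k.
Proof.
have [K [m [e [mm ee fe]]]] := image_ex (bcopair (ts_inc i) (ts_inc j)).
have CK : C K.
  by apply: thick_quo ee _ => //; apply: (thick_bip thC); apply: ts_mem.
exists (Tsub mm CK); split; [exists (e \oc in1 _ _)|exists (e \oc in2 _ _)].
  by rewrite compA /= -fe bcopair_in1.
by rewrite compA /= -fe bcopair_in2.
Qed.

Definition shom_sys M N : dirsys.
Proof.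
refine (@Dirsys (csub M * tsub N)%type
  (fun i j => cs_le i.1 j.1 /\ ts_le i.2 j.2)
  (fun i => hom (cs_dom i.1) (ts_coker i.2))
  (fun i j h f => ts_quo (proj2 h) \oc f \oc cs_res (proj1 h))
  _ _ _ _ _ _ _).
- by exists (csub_full M, tsub_zero N).
- by move=> i; split; [apply: cs_le_refl|apply: ts_le_refl].
- move=> i j k [h1 h2] [h1' h2'].
  by split; [apply: cs_le_trans h1 h1'|apply: ts_le_trans h2 h2'].
- move=> [i i'] [j j'] /=; have [k [? ?]] := cs_dir i j.
  by have [k' [? ?]] := ts_dir i' j'; exists (k, k').
- move=> [i j] h f.
  rewrite -(@cs_res_uniq _ _ _ (proj1 h) (idm _)) ?compm1 //.
  suff -> : ts_quo (proj2 h) = idm _ by rewrite comp1m.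
  by apply: (ts_proj_epi (j := j)); rewrite ts_quoP comp1m.
- move=> i j k h h' h'' f; rewrite -!compA.
  rewrite -(@cs_res_uniq _ _ _ (proj1 h'')
     (cs_res (proj1 h) \oc cs_res (proj1 h'))).
    rewrite !compA; congr (_ \oc _ \oc _ \oc _).
    by apply: (ts_proj_epi (j := i.2)); rewrite -compA !ts_quoP.
  by rewrite compA !cs_resP.
- by move=> i j h f g; rewrite compDr compDl.
Defined.

Definition shom M N : zmodType := dirlim (shom_sys M N).

Definition sin M N (i : csub M) (j : tsub N) (f : hom (cs_dom i) (ts_coker j)) :
  shom M N := @dl_in (shom_sys M N) (i, j) f.

Lemma shom_ind M N (P : shom M N -> Prop) :
  (forall i j f, P (@sin M N i j f)) -> forall a, P a.
Proof. by move=> H a; elim/dl_ind: a => -[i j] f; apply: H. Qed.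

(* The morphism a is the fraction h s^-1, for s with kernel and cokernel in C. *)
Definition is_frac M N X (s : hom X M) (h : hom X N) (a : shom M N) : Prop :=
  Ciso C s /\ exists i j f (k : hom X (cs_dom i)),
    [/\ a = @sin M N i j f, cs_inc i \oc k = s & f \oc k = ts_proj j \oc h].

Lemma frac_move M N X (s : hom X M) (h : hom X N) (i i' : csub M)
    (j j' : tsub N) (f : hom (cs_dom i) (ts_coker j)) k k'
    (le : @ds_le (shom_sys M N) (i, j) (i', j')) :
  cs_inc i \oc k = s -> f \oc k = ts_proj j \oc h -> cs_inc i' \oc k' = s ->
  (@ds_map (shom_sys M N) _ _ le f) \oc k' = ts_proj j' \oc h.
Proof.
move=> e1 e2 e3 /=; rewrite -!compA.
have -> : cs_res (proj1 le) \oc k' = k.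
  by apply: (cs_mono (c := i)); rewrite e1 -e3 compA cs_resP.
by rewrite e2 compA ts_quoP.
Qed.

Lemma csub_image M X (s : hom X M) : C (coker s) ->
  exists (l : csub M) (e : hom X (cs_dom l)), is_epi e /\ cs_inc l \oc e = s.
Proof.
have [K [m [e [mm ee ->]]]] := image_ex s => /(Ccoker_of_comp thC) Cm.
by exists (Csub mm Cm), e.
Qed.

Lemma cs_le_image M X (s : hom X M) (i l : csub M) k e :
  cs_inc i \oc k = s -> cs_inc l \oc e = s -> is_epi e -> cs_le i l.
Proof.
move=> e1 e2 ee; apply: mono_factor; first exact: cs_mono.
move=> w u ui; apply: (epi0 ee).
by rewrite -compA e2 -e1 compA ui comp0m.
Qed.

Lemma frac_fun M N X (s : hom X M) (h : hom X N) a b :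
  is_frac s h a -> is_frac s h b -> a = b.
Proof.
move=> [Cs [i [j [f [k [-> e1 e2]]]]]] [_ [i' [j' [f' [k' [-> e1' e2']]]]]].
have [l [e [ee el]]] := csub_image Cs.2.
have [j2 [lj lj']] := ts_dir j j'.
have le : @ds_le (shom_sys M N) (i, j) (l, j2).
  by split=> //=; apply: cs_le_image e1 el ee.
have le' : @ds_le (shom_sys M N) (i', j') (l, j2).
  by split=> //=; apply: cs_le_image e1' el ee.
apply/dl_in_eqP; exists (l, j2), le, le'; apply: ee.
by rewrite (frac_move le e1 e2 el) (frac_move le' e1' e2' el).
Qed.

Lemma frac_ex M N X (s : hom X M) (h : hom X N) :
  Ciso C s -> exists a, is_frac s h a.
Proof.
move=> Cs; have [l [e [ee el]]] := csub_image Cs.2.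
have [K [m [e' [mm ee' me]]]] := image_ex (h \oc kerm s).
have CK : C K by apply: (thick_quo thC ee'); case: Cs.
pose j := Tsub mm CK.
have [w u eu|f ef] := epi_factor (f := e) (g := ts_proj j \oc h) ee.
  have [|v ev] := kernel_lift (u := u) (kerP s).
    by rewrite -el -compA eu compm0.
  rewrite -ev -!compA (compA h) me !compA.
  by rewrite (comp_cokerm m) !comp0m.
by exists (sin f); split=> //; exists l, j, f, e.
Qed.

Lemma frac_rep M N (a : shom M N) :
  exists X (s : hom X M) (h : hom X N), is_frac s h a.
Proof.
elim/shom_ind: a => i j f.
have [X [h [k pb]]] := pullback_ex (ts_proj j) f.
exists X, (cs_inc i \oc k), h; split.
  apply: (Ciso_comp thC); first exact: csub_Ciso.
  by apply: (Ciso_pull thC pb); apply: tsub_Ciso.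
by exists i, j, f, k; split=> //; rewrite pb.1.
Qed.

Lemma frac_refine M N X (s : hom X M) (h : hom X N) a Y (t : hom Y X) :
  is_frac s h a -> Ciso C (s \oc t) -> is_frac (s \oc t) (h \oc t) a.
Proof.
move=> [Cs [i [j [f [k [-> e1 e2]]]]]] Ct; split=> //.
by exists i, j, f, (k \oc t); rewrite !compA e1 e2.
Qed.

Lemma frac_common M N X (s : hom X M) (h : hom X N) X' (s' : hom X' M)
    (h' : hom X' N) a :
  is_frac s h a -> is_frac s' h' a ->
  exists T (t : hom T X) (t' : hom T X'),
    [/\ s \oc t = s' \oc t', Ciso C (s \oc t) & h \oc t = h' \oc t'].
Proof.
move=> [Cs [i [j [f [k [-> e1 e2]]]]]] [Cs' [i' [j' [f' [k' [e e1' e2']]]]]].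
have [[l l2] [le [le' E]]] := proj1 (dl_in_eqP _ _) e.
have [P [p1 [p2 pb]]] := pullback_ex s (cs_inc l).
have [P' [p1' [p2' pb']]] := pullback_ex s' (cs_inc l).
have [R [r [r' pbR]]] := pullback_ex p2 p2'.
have Cr' : Ciso C r' by apply: (Ciso_pull thC pbR); apply: (Ciso_pull thC pb).
have Cp' : Ciso C p2' by apply: (Ciso_pull thC pb').
pose d := p2' \oc r'.
have sd : s \oc (p1 \oc r) = cs_inc l \oc d.
  by rewrite compA pb.1 -compA pbR.1.
have sd' : s' \oc (p1' \oc r') = cs_inc l \oc d by rewrite compA pb'.1 -compA.
have z : ts_proj l2 \oc (h \oc (p1 \oc r) - h' \oc (p1' \oc r')) = 0.
  have a1 := frac_move (s := cs_inc l \oc d) (h := h \oc (p1 \oc r))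
     (k := k \oc (p1 \oc r)) (k' := d) le.
  have a2 := frac_move (s := cs_inc l \oc d) (h := h' \oc (p1' \oc r'))
     (k := k' \oc (p1' \oc r')) (k' := d) le'.
  rewrite compBr -(a1 f) -?(a2 f') ?E ?subrr // compA ?e1 ?e1' ?e2 ?e2' //;
    by rewrite -compA.
have [eps e3] := kernel_lift
  (mono_kernel (ts_mono (t := l2)) (cokerP (ts_inc l2))) z.
exists (ker eps), (p1 \oc r \oc kerm eps), (p1' \oc r' \oc kerm eps).
rewrite ![_ \oc (_ \oc kerm eps)]compA sd sd'; split=> //.
  apply: (Ciso_comp thC); last exact/(ker_to_C thC)/ts_mem.
  apply: (Ciso_comp thC); first exact: csub_Ciso.
  exact: (Ciso_comp thC).
apply/eqP; rewrite -subr_eq0 -compBl -e3 -compA comp_kerm compm0; exact/eqP.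
Qed.

Definition smap M N (f : hom M N) : shom M N :=
  @sin M N (csub_full M) (tsub_zero N) (ts_proj (tsub_zero N) \oc f).

Lemma frac_smap M N (f : hom M N) : is_frac (idm M) f (smap f).
Proof.
split; first exact: (Ciso_id thC).
by exists (csub_full M), (tsub_zero N), (ts_proj (tsub_zero N) \oc f), (idm M);
   rewrite !compm1.
Qed.

Lemma smap0 M N : smap (0 : hom M N) = 0.
Proof. by rewrite /smap compm0; apply: dl_in0E. Qed.

Lemma frac0 M N X (s : hom X M) : Ciso C s -> is_frac s (0 : hom X N) 0.
Proof.
move=> Cs; have := frac_refine (t := s) (frac_smap (0 : hom M N)).
by rewrite comp1m comp0m smap0; apply.
Qed.

Lemma frac_eq0 M N X (s : hom X M) (h : hom X N) : is_frac s h 0 ->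
  exists Y (t : hom Y X), Ciso C (s \oc t) /\ h \oc t = 0.
Proof.
move=> H; have [T [t [t' [_ Ct e]]]] := frac_common H (frac0 N H.1).
by exists T, t; rewrite e comp0m.
Qed.

Lemma frac_add M N X (s : hom X M) (h h' : hom X N) a b :
  is_frac s h a -> is_frac s h' b -> is_frac s (h + h') (a + b).
Proof.
move=> [Cs [i [j [f [k [-> e1 e2]]]]]] [_ [i' [j' [f' [k' [-> e1' e2']]]]]].
have [l [e [ee el]]] := csub_image Cs.2.
have [j2 [lj lj']] := ts_dir j j'.
have le : @ds_le (shom_sys M N) (i, j) (l, j2).
  by split=> //=; apply: cs_le_image e1 el ee.
have le' : @ds_le (shom_sys M N) (i', j') (l, j2).
  by split=> //=; apply: cs_le_image e1' el ee.
split=> //; exists l, j2, (ds_map le f + ds_map le' f'), e; split=> //.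
  exact: dl_inD.
by rewrite compDl (frac_move le e1 e2 el) (frac_move le' e1' e2' el) compDr.
Qed.

Lemma frac_common_den M N (a b : shom M N) :
  exists X (s : hom X M) (h h' : hom X N), is_frac s h a /\ is_frac s h' b.
Proof.
have [X [s [h H]]] := frac_rep a; have [X' [s' [h' H']]] := frac_rep b.
have [P [p [p' pb]]] := pullback_ex s s'.
have Cs : Ciso C (s \oc p).
  by rewrite pb.1; apply: (Ciso_comp thC H'.1); apply: (Ciso_pull thC pb H.1).
exists P, (s \oc p), (h \oc p), (h' \oc p'); split; first exact: frac_refine.
by rewrite pb.1; apply: frac_refine => //; rewrite -pb.1.
Qed.

(* (g t^-1) (h s^-1) = (g w2) (s w1)^-1 whenever h w1 = t w2. *)
Definition scomp_rel M N L (b : shom N L) (a : shom M N) (c : shom M L) : Prop :=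
  exists X (s : hom X M) (h : hom X N) Y (t : hom Y N) (g : hom Y L)
         W (w1 : hom W X) (w2 : hom W Y),
    [/\ is_frac s h a, is_frac t g b, h \oc w1 = t \oc w2
      & is_frac (s \oc w1) (g \oc w2) c].

Lemma scomp_ex M N L (b : shom N L) (a : shom M N) : exists c, scomp_rel b a c.
Proof.
have [X [s [h H]]] := frac_rep a; have [Y [t [g H']]] := frac_rep b.
have [W [w2 [w1 pb]]] := pullback_ex t h.
have Cw : Ciso C (s \oc w1).
  by apply: (Ciso_comp thC H.1); apply: (Ciso_pull thC pb H'.1).
have [c Hc] := frac_ex (g \oc w2) Cw.
by exists c, X, s, h, Y, t, g, W, w1, w2; rewrite pb.1.
Qed.

Definition scomp M N L (b : shom N L) (a : shom M N) : shom M L :=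
  sval (cid (scomp_ex b a)).

Lemma scomp_fun M N L (b : shom N L) (a : shom M N) c c' :
  scomp_rel b a c -> scomp_rel b a c' -> c = c'.
Proof.
move=> [X [s [h [Y [t [g [W [w1 [w2 [Ha Hb e Hc]]]]]]]]]].
move=> [X' [s' [h' [Y' [t' [g' [W' [w1' [w2' [Ha' Hb' e' Hc']]]]]]]]]].
have [T [r [r' [sr Csr hr]]]] := frac_common Ha Ha'.
have [U [q [q' [tq Ctq gq]]]] := frac_common Hb Hb'.
have [V [v2 [v1 pb]]] := pullback_ex (t \oc q) (h \oc r).
have Cv : Ciso C (s \oc r \oc v1).
  by apply: (Ciso_comp thC Csr); apply: (Ciso_pull thC pb Ctq).
have key Z (x : hom Z X) (y : hom Z Y) (k : hom V X) (l : hom V Y) d :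
    h \oc x = t \oc y -> h \oc k = t \oc l -> Ciso C (s \oc k) ->
    is_frac (s \oc x) (g \oc y) d -> is_frac (s \oc k) (g \oc l) d.
  move=> exy ekl Ck Hd.
  have [P [p2 [p1 pbP]]] := pullback_ex t h.
  have [u [u2 u1]] := pullback_lift pbP (esym exy).
  have [v [e2 e1]] := pullback_lift pbP (esym ekl).
  have Cp : Ciso C (s \oc p1).
    by apply: (Ciso_comp thC Ha.1); apply: (Ciso_pull thC pbP Hb.1).
  have [d' Hd'] := frac_ex (g \oc p2) Cp.
  have dd' : d = d'.
    apply: (frac_fun Hd).
    rewrite -u1 -u2 !compA; apply: frac_refine => //.
    by rewrite -compA u1; case: Hd.
  rewrite dd' -e1 -e2 !compA; apply: frac_refine => //.
  by rewrite -compA e1.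
have key' Z (x : hom Z X') (y : hom Z Y') (k : hom V X') (l : hom V Y') d :
    h' \oc x = t' \oc y -> h' \oc k = t' \oc l -> Ciso C (s' \oc k) ->
    is_frac (s' \oc x) (g' \oc y) d -> is_frac (s' \oc k) (g' \oc l) d.
  move=> exy ekl Ck Hd.
  have [P [p2 [p1 pbP]]] := pullback_ex t' h'.
  have [u [u2 u1]] := pullback_lift pbP (esym exy).
  have [v [e2 e1]] := pullback_lift pbP (esym ekl).
  have Cp : Ciso C (s' \oc p1).
    by apply: (Ciso_comp thC Ha'.1); apply: (Ciso_pull thC pbP Hb'.1).
  have [d' Hd'] := frac_ex (g' \oc p2) Cp.
  have dd' : d = d'.
    apply: (frac_fun Hd).
    rewrite -u1 -u2 !compA; apply: frac_refine => //.
    by rewrite -compA u1; case: Hd.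
  rewrite dd' -e1 -e2 !compA; apply: frac_refine => //.
  by rewrite -compA e1.
have F := key _ _ _ (r \oc v1) (q \oc v2) _ e _ _ Hc.
have F' := key' _ _ _ (r' \oc v1) (q' \oc v2) _ e' _ _ Hc'.
apply: (frac_fun (s := s \oc r \oc v1) (h := g \oc q \oc v2)).
  by rewrite -!compA; apply: F; rewrite ?compA ?pb.1.
rewrite sr gq -!compA; apply: F'; rewrite !compA ?hr -?sr //.
by rewrite -tq -hr pb.1.
Qed.

Lemma scompE M N L (b : shom N L) (a : shom M N) X (s : hom X M) (h : hom X N)
    Y (t : hom Y N) (g : hom Y L) W (w1 : hom W X) (w2 : hom W Y) :
  is_frac s h a -> is_frac t g b -> h \oc w1 = t \oc w2 ->
  Ciso C (s \oc w1) -> is_frac (s \oc w1) (g \oc w2) (scomp b a).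
Proof.
move=> Ha Hb e Cw; have [c Hc] := frac_ex (g \oc w2) Cw.
suff -> : scomp b a = c by [].
apply: (@scomp_fun _ _ _ b a); first exact: proj2_sig (cid (scomp_ex b a)).
by exists X, s, h, Y, t, g, W, w1, w2.
Qed.

Lemma frac_comp_common M N L (b : shom N L) (a : shom M N) :
  exists X (s : hom X M) (h : hom X N) Y (t : hom Y N) (g : hom Y L)
         (w2 : hom X Y),
    [/\ is_frac s h a, is_frac t g b & h = t \oc w2].
Proof.
have [X [s [h H]]] := frac_rep a; have [Y [t [g H']]] := frac_rep b.
have [W [w2 [w1 pb]]] := pullback_ex t h.
exists W, (s \oc w1), (h \oc w1), Y, t, g, w2; split; rewrite ?pb.1 //.
  apply: frac_refine => //.
  by apply: (Ciso_comp thC H.1); apply: (Ciso_pull thC pb H'.1).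
Qed.

Lemma scompE1 M N L (b : shom N L) (a : shom M N) X (s : hom X M)
    Y (t : hom Y N) (g : hom Y L) (w2 : hom X Y) :
  is_frac s (t \oc w2) a -> is_frac t g b -> is_frac s (g \oc w2) (scomp b a).
Proof.
move=> Ha Hb; have := scompE (w1 := idm X) (w2 := w2) Ha Hb.
by rewrite !compm1; apply=> //; case: Ha.
Qed.

Lemma scomp1m M N (a : shom M N) : scomp (smap (idm N)) a = a.
Proof.
have [X [s [h H]]] := frac_rep a.
apply: (frac_fun _ H); rewrite -[h]comp1m; apply: scompE1 (frac_smap _).
by rewrite comp1m.
Qed.

Lemma scompm1 M N (a : shom M N) : scomp a (smap (idm M)) = a.
Proof.
have [X [s [h H]]] := frac_rep a.
have F := frac_refine (t := s) (frac_smap (idm M)).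
apply: (frac_fun _ H); rewrite -[h]compm1; apply: (scompE1 _ H).
rewrite compm1; move: F; rewrite comp1m; apply; by case: H.
Qed.

Lemma scompA M N L K (c : shom L K) (b : shom N L) (a : shom M N) :
  scomp c (scomp b a) = scomp (scomp c b) a.
Proof.
have [Y [t [g [U [u [k [z [Hb Hc e]]]]]]]] := frac_comp_common c b.
have [X [s [h Ha]]] := frac_rep a.
have [W [w2 [w1 pb]]] := pullback_ex t h.
have Ha' : is_frac (s \oc w1) (t \oc w2) a.
  rewrite pb.1; apply: frac_refine => //.
  by apply: (Ciso_comp thC Ha.1); apply: (Ciso_pull thC pb Hb.1).
rewrite e in Hb.
apply: (frac_fun (s := s \oc w1) (h := k \oc (z \oc w2))).
  apply: scompE1 Hc; rewrite compA; exact: scompE1 Ha' Hb.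
by rewrite compA; apply: scompE1 Ha' _; apply: scompE1 Hb Hc.
Qed.

Lemma scompDl M N L (b b' : shom N L) (a : shom M N) :
  scomp (b + b') a = scomp b a + scomp b' a.
Proof.
have [Y [t [g [g' [Hb Hb']]]]] := frac_common_den b b'.
have [X [s [h Ha]]] := frac_rep a.
have [W [w2 [w1 pb]]] := pullback_ex t h.
have Ha' : is_frac (s \oc w1) (t \oc w2) a.
  rewrite pb.1; apply: frac_refine => //.
  by apply: (Ciso_comp thC Ha.1); apply: (Ciso_pull thC pb Hb.1).
apply: (frac_fun (s := s \oc w1) (h := (g + g') \oc w2)).
  exact: scompE1 Ha' (frac_add Hb Hb').
by rewrite compDl; apply: frac_add; [apply: scompE1 Hb|apply: scompE1 Hb'].
Qed.

Lemma scompDr M N L (b : shom N L) (a a' : shom M N) :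
  scomp b (a + a') = scomp b a + scomp b a'.
Proof.
have [X [s [h [h' [Ha Ha']]]]] := frac_common_den a a'.
have [Y [t [g Hb]]] := frac_rep b.
have [W [w2 [w1 pb]]] := pullback_ex t h.
have [W' [w2' [w1' pb']]] := pullback_ex t h'.
have [V [v [v' pbV]]] := pullback_ex w1 w1'.
have Cw' := Ciso_pull thC pb' Hb.1.
have Cs : Ciso C (s \oc (w1' \oc v')).
  apply: (Ciso_comp thC Ha.1); apply: (Ciso_comp thC Cw').
  by apply: (Ciso_pull thC pbV); apply: (Ciso_pull thC pb Hb.1).
have F : is_frac (s \oc (w1' \oc v')) (t \oc (w2 \oc v)) a.
  rewrite (compA t) pb.1 -compA pbV.1; exact: frac_refine.
have F' : is_frac (s \oc (w1' \oc v')) (t \oc (w2' \oc v')) a'.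
  rewrite (compA t) pb'.1 -compA; exact: frac_refine.
apply: (frac_fun (s := s \oc (w1' \oc v'))
                 (h := g \oc (w2 \oc v + w2' \oc v'))).
  by apply: scompE1 Hb; rewrite compDr; apply: frac_add.
by rewrite compDr; apply: frac_add; [apply: scompE1 F _|apply: scompE1 F' _].
Qed.

Definition serre_preadd : preadd :=
  @Preadd (ob A) shom (fun M => smap (idm M)) scomp
    (fun _ _ _ _ c b a => scompA c b a) scomp1m scompm1 scompDl scompDr.

Lemma smap_comp M N L (g : hom N L) (f : hom M N) :
  smap (g \oc f) = scomp (smap g) (smap f).
Proof.
apply: frac_fun (frac_smap _) _; apply: scompE1 (frac_smap _).
by rewrite comp1m; apply: frac_smap.
Qed.

Definition serre_functor : functor A serre_preadd :=
  @Functor A serre_preadd (fun M => M) smap (fun M => erefl) smap_comp.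

End SerreHom.

Section IsoTransport.
Variable B : preadd.
Implicit Types x y z k : B.

Lemma iso_kernel x y z (a : hom y z) (u : hom x y) k (i : hom k x) :
  is_iso u -> is_kernel (a \oc u) i -> is_kernel a (u \oc i).
Proof.
move=> iu [e H]; have [v [vu uv]] := iu; apply: mk_kernel.
- by rewrite compA.
- apply: mono_comp; first exact: iso_mono.
  exact: (@kernel_mono _ _ _ (a \oc u)).
move=> w t at0; have [|l [el _]] := H _ (v \oc t).
  by rewrite compA -(compA a) uv compm1.
by exists l; rewrite -compA el compA uv comp1m.
Qed.

Lemma iso_kernel_r x y k k' (a : hom x y) (i : hom k x) (u : hom k' k) :
  is_iso u -> is_kernel a i -> is_kernel a (i \oc u).
Proof.
move=> iu ki; have [v [vu uv]] := iu; apply: mk_kernel.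
- by rewrite compA ki.1 comp0m.
- apply: mono_comp; [exact: kernel_mono ki | exact: iso_mono].
move=> w t at0; have [l <-] := kernel_lift ki at0.
by exists (v \oc l); rewrite -compA (compA u) uv comp1m.
Qed.

Lemma iso_inv_iso x y (u : hom x y) (v : hom y x) :
  v \oc u = idm x -> u \oc v = idm y -> is_iso v.
Proof. by exists u. Qed.

End IsoTransport.

Section IsoTransportDual.
Variable B : preadd.
Implicit Types x y z k : B.

Lemma op_iso x y (u : hom x y) : is_iso u -> @is_iso (op_preadd B) y x u.
Proof. by case=> v [e e']; exists v. Qed.

Lemma iso_cokernel x y z (a : hom z y) (u : hom y x) k (q : hom x k) :
  is_iso u -> is_cokernel (u \oc a) q -> is_cokernel a (q \oc u).
Proof. by move=> /op_iso; apply: (@iso_kernel (op_preadd B) x y z a u k q). Qed.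

Lemma iso_cokernel_r x y k k' (a : hom y x) (q : hom x k) (u : hom k k') :
  is_iso u -> is_cokernel a q -> is_cokernel a (u \oc q).
Proof. by move=> /op_iso; apply: (@iso_kernel_r (op_preadd B) x y k k' a q u). Qed.

End IsoTransportDual.

Section SerreAbelian.
Variables (A : abelian) (C : thick A).
Let thC := thickP C.
Let B := serre_preadd C.
Implicit Types x y z : A.

Definition qhom x y (f : hom x y) : @hom B x y := smap C f.

Lemma qhom_id x : qhom (idm x) = @idm B x. Proof. by []. Qed.

Lemma qhom_comp x y z (g : hom y z) (f : hom x y) : qhom (g \oc f) = qhom g \oc qhom f.
Proof. exact: smap_comp. Qed.

Lemma qhom_add x y (f g : hom x y) : qhom (f + g) = qhom f + qhom g.
Proof.
apply: (frac_fun (frac_smap C (f + g))); apply: frac_add; exact: frac_smap.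
Qed.

Lemma qhom_0 x y : qhom (0 : hom x y) = 0. Proof. exact: smap0. Qed.

Lemma frac_qhom x y t (s : hom t x) (h : hom t y) (a : @hom B x y) :
  is_frac s h a -> a \oc qhom s = qhom h.
Proof.
move=> H; apply: (frac_fun _ (frac_smap C h)).
rewrite -[h]compm1; apply: (scompE1 _ H); rewrite compm1; exact: frac_smap.
Qed.

Lemma qhom_iso x y (f : hom x y) : Ciso C f -> is_iso (qhom f).
Proof.
move=> Cf; have [b Hb] := frac_ex (idm x) Cf.
exists b; split; first by rewrite (frac_qhom Hb).
have H1 : is_frac f f (qhom f \oc b).
  rewrite -{2}[f]compm1; apply: scompE1 (frac_smap C f).
  by rewrite comp1m.
apply: (frac_fun H1).
have := frac_refine (t := f) (frac_smap C (idm y)).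
by rewrite comp1m; apply.
Qed.

Lemma qhom_roof x y (a : @hom B x y) :
  exists t (s : hom t x) (h : hom t y), Ciso C s /\ a \oc qhom s = qhom h.
Proof.
have [t [s [h H]]] := frac_rep a; exists t, s, h.
by split; [case: H | exact: frac_qhom].
Qed.

Lemma qhom_coroof x y (a : @hom B x y) :
  exists t (p : hom y t) (h : hom x t), Ciso C p /\ qhom p \oc a = qhom h.
Proof.
have [t [s [h [Cs e]]]] := qhom_roof a.
have [z [h' [p po]]] := pushout_ex s h.
exists z, p, h'; split; first exact: (Ciso_push thC po).
apply: (iso_epi (qhom_iso Cs)).
by rewrite -compA e -!qhom_comp po.1.
Qed.

Lemma qhom_eq0 x y (f : hom x y) : qhom f = 0 ->
  exists t (r : hom t x), Ciso C r /\ f \oc r = 0.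
Proof.
move=> e; have : is_frac (idm x) f (0 : shom C x y) by rewrite -e; apply: frac_smap.
by case/frac_eq0 => t [r [Cr fr]]; exists t, r; rewrite comp1m in Cr.
Qed.

Lemma qhom_eq0' x y (f : hom x y) : qhom f = 0 ->
  exists t (p : hom y t), Ciso C p /\ p \oc f = 0.
Proof.
move=> /qhom_eq0 [t [r [Cr fr]]].
have [g eg] := cokernel_desc (cokerP r) fr.
exists (coker g), (cokerm g); split.
  by apply: (coker_from_C thC); case: Cr.
by rewrite -eg compA comp_cokerm comp0m.
Qed.

Lemma qhom_mono x y (f : hom x y) : is_mono f -> is_mono (qhom f).
Proof.
move=> mf; apply: monoP => w u e; have [t [s [h [Cs us]]]] := qhom_roof u.
have [|t' [r [Cr]]] := qhom_eq0 (f := f \oc h).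
  by rewrite qhom_comp -us compA e comp0m.
rewrite -compA => /(mono0 mf) hr.
apply: (epi0 (iso_epi (qhom_iso Cs))); rewrite us.
by apply: (epi0 (iso_epi (qhom_iso Cr))); rewrite -qhom_comp hr qhom_0.
Qed.

Lemma qhom_epi x y (f : hom x y) : is_epi f -> is_epi (qhom f).
Proof.
move=> ef; apply: epiP => w u e; have [t [p [h [Cp us]]]] := qhom_coroof u.
have [|t' [r [Cr]]] := qhom_eq0' (f := h \oc f).
  by rewrite qhom_comp -us -compA e compm0.
rewrite compA => /(epi0 ef) hr.
apply: (mono0 (iso_mono (qhom_iso Cp))); rewrite us.
by apply: (mono0 (iso_mono (qhom_iso Cr))); rewrite -qhom_comp hr qhom_0.
Qed.

Lemma qhom_kernel x y k (f : hom x y) (i : hom k x) :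
  is_kernel f i -> is_kernel (qhom f) (qhom i).
Proof.
move=> ki; apply: mk_kernel.
- by rewrite -qhom_comp ki.1 qhom_0.
- exact/qhom_mono/(kernel_mono ki).
move=> w u e; have [t [s [h [Cs us]]]] := qhom_roof u.
have [|t' [r [Cr]]] := qhom_eq0 (f := f \oc h).
  by rewrite qhom_comp -us compA e comp0m.
rewrite -compA => /(kernel_lift ki)[v ev].
have [b [_ sb]] := qhom_iso Cs; have [d [_ rd]] := qhom_iso Cr.
exists (qhom v \oc d \oc b).
by rewrite !compA -qhom_comp ev qhom_comp -us -!compA (compA _ d b) rd comp1m sb compm1.
Qed.

Lemma qhom_cokernel x y k (f : hom x y) (q : hom y k) :
  is_cokernel f q -> is_cokernel (qhom f) (qhom q).
Proof.
move=> ki; apply: mk_cokernel.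
- by rewrite -qhom_comp ki.1 qhom_0.
- exact/qhom_epi/(cokernel_epi ki).
move=> w u e; have [t [p [h [Cp us]]]] := qhom_coroof u.
have [|t' [r [Cr]]] := qhom_eq0' (f := h \oc f).
  by rewrite qhom_comp -us -compA e compm0.
rewrite compA => /(cokernel_desc ki)[v ev].
have [b [bp _]] := qhom_iso Cp; have [d [dr _]] := qhom_iso Cr.
exists (b \oc d \oc qhom v).
by rewrite -!compA -qhom_comp ev qhom_comp -us !compA -(compA b) dr compm1 bp comp1m.
Qed.

Lemma qhom_mono_inv x y (f : hom x y) : is_mono (qhom f) -> C (ker f).
Proof.
move=> mf; have /(mono0 mf)/qhom_eq0 [t [r [[_ Cr] kr]]] : qhom f \oc qhom (kerm f) = 0.
  by rewrite -qhom_comp comp_kerm qhom_0.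
have r0 : r = 0 by apply: (@kerm_mono _ _ _ f); rewrite kr compm0.
have [|v ev] := cokernel_desc (u := idm _) (cokerP r); first by rewrite r0 compm0.
apply: (thick_sub thC _ Cr); apply: (@mono_of_comp _ _ _ _ v (cokerm r)).
rewrite ev; exact: mono_id.
Qed.

Lemma qhom_epi_inv x y (f : hom x y) : is_epi (qhom f) -> C (coker f).
Proof.
move=> ef; have /(epi0 ef)/qhom_eq0' [t [r [[Cr _] kr]]] : qhom (cokerm f) \oc qhom f = 0.
  by rewrite -qhom_comp comp_cokerm qhom_0.
have r0 : r = 0 by apply: (@cokerm_epi _ _ _ f); rewrite kr comp0m.
have [|v ev] := kernel_lift (u := idm _) (kerP r); first by rewrite r0 comp0m.
apply: (thick_quo thC _ Cr); apply: (@epi_of_comp _ _ _ _ (kerm r) v).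
rewrite ev; exact: epi_id.
Qed.

Lemma serre_is_abelian : is_abelian B.
Proof.
split.
- exists (zob : A); split=> x a.
    have [t [s [h [Cs us]]]] := qhom_roof a.
    apply: (epi0 (iso_epi (qhom_iso Cs))).
    by rewrite us (to_zob h) qhom_0.
  have [t [p [h [Cp us]]]] := qhom_coroof a.
  apply: (mono0 (iso_mono (qhom_iso Cp))).
  by rewrite us (of_zob h) qhom_0.
- move=> x y; exists (bip x y), (qhom (in1 x y)), (qhom (in2 x y)), (qhom (pr1 x y)),
    (qhom (pr2 x y)).
  by split; rewrite -!qhom_comp -?qhom_add ?pr1in1 ?pr2in2 ?pr1in2 ?pr2in1 ?bip_id
    -?qhom_id ?qhom_0.
- move=> x y a; have [t [s [h [Cs e]]]] := qhom_roof a.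
  exists (ker h), (qhom s \oc qhom (kerm h)); apply: iso_kernel; first exact: qhom_iso.
  by rewrite e; apply/qhom_kernel/kerP.
- move=> x y a; have [t [p [h [Cp e]]]] := qhom_coroof a.
  exists (coker h), (qhom (cokerm h) \oc qhom p); apply: iso_cokernel.
    exact: qhom_iso.
  by rewrite e; apply/qhom_cokernel/cokerP.
- move=> x y a ma; have [t [s [h [Cs e]]]] := qhom_roof a.
  have iS := qhom_iso Cs; have [b [bs sb]] := iS.
  have -> : a = qhom h \oc b by rewrite -e -compA sb compm1.
  have mh : is_mono (qhom h) by rewrite -e; apply: mono_comp => //; apply: iso_mono.
  have [k [m [d [mm ed hd]]]] := image_ex h.
  have Cd : Ciso C d.
    split; last exact: (Ccoker_epi thC).
    by move: (qhom_mono_inv mh); rewrite hd => /(Cker_of_comp thC).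
  exists (coker m), (qhom (cokerm m)); apply: (iso_kernel_r (iso_inv_iso bs sb)).
  rewrite hd qhom_comp; apply: (iso_kernel_r (qhom_iso Cd)); apply: qhom_kernel.
  exact/(mono_kernel mm)/cokerP.
move=> x y a ea; have [t [p [h [Cp e]]]] := qhom_coroof a.
have iP := qhom_iso Cp; have [b [bp pb]] := iP.
have -> : a = b \oc qhom h by rewrite -e compA bp comp1m.
have eh : is_epi (qhom h) by rewrite -e; apply: epi_comp => //; apply: iso_epi.
have [k [m [d [mm ed hd]]]] := image_ex h.
have Cm : Ciso C m.
  split; first exact: (Cker_mono thC).
  by move: (qhom_epi_inv eh); rewrite hd => /(Ccoker_of_comp thC).
exists (ker d), (qhom (kerm d)); apply: (iso_cokernel_r (iso_inv_iso bp pb)).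
rewrite hd qhom_comp; apply: (iso_cokernel_r (qhom_iso Cm)); apply: qhom_cokernel.
exact/(epi_cokernel ed)/kerP.
Qed.

(* [f : M' -> N/N'] is Q(N -> N/N')^-1 Q(f) Q(M' -> M)^-1. *)
Lemma sinE M N (i : csub C M) (j : tsub C N) (f : hom (cs_dom i) (ts_coker j)) :
  qhom (ts_proj j) \oc (sin f : @hom B M N) \oc qhom (cs_inc i) = qhom f.
Proof.
have [X [h [k pb]]] := pullback_ex (ts_proj j) f.
have Ck : Ciso C k by apply: (Ciso_pull thC pb); apply: tsub_Ciso.
have H : is_frac (cs_inc i \oc k) h (sin f).
  split; first by apply: (Ciso_comp thC) Ck; apply: csub_Ciso.
  by exists i, j, f, k; rewrite pb.1.
apply: (iso_epi (qhom_iso Ck)).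
by rewrite -!compA -[qhom (cs_inc i) \oc _]qhom_comp (frac_qhom H) -!qhom_comp pb.1.
Qed.

Definition serre : abelian := Abelian serre_is_abelian.

Definition qfun : functor A serre := serre_functor C.

Lemma qfun_exact : exact_functor qfun.
Proof.
split=> [x y f g|x y z i p [mi ep ex]]; first exact: qhom_add.
split; [exact: qhom_mono | exact: qhom_epi |].
exact/(@kernel_exact serre)/qhom_kernel/exact_kernel.
Qed.

End SerreAbelian.

Section Torsion.
Variables (A : abelian) (C : thick A).
Implicit Types M N X E : A.

Definition torsion_free M : Prop :=
  forall X (i : hom X M), is_mono i -> C X -> is_zero X.

Definition saturated M : Prop :=
  torsion_free M /\
  forall E X (i : hom M E) (p : hom E X), short_exact i p -> C X ->
    exists r : hom E M, r \oc i = idm M.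

Definition almost_complement M X (i : hom X M) : Prop :=
  [/\ is_mono i, torsion_free X & C (coker i)].

Definition almost_split : Prop :=
  forall M, exists X (i : hom X M), almost_complement i.

Definition localizing : Prop :=
  exists S : functor (serre C) A, right_adjoint (qfun C) S.

End Torsion.

Section LimExt.
Variables (A : abelian) (C : thick A).
Implicit Types (c : nat) (M L N P : A).
Let thC := thickP C.

(* The direct system Ext^c(M', N), over the subobjects M' <= M with
   M/M' in C. *)
Definition ext_sys c M N : dirsys.
Proof.
refine (@Dirsys (csub C M) (@cs_le _ C M) (fun i => Ext c (cs_dom i) N)
  (fun i j h a => epull (cs_res h) a) _ _ _ _ _ _ _).
- by exists (csub_full C M).
- exact: cs_le_refl.
- exact: cs_le_trans.
- exact: cs_dir.
- by move=> i h a; rewrite -(@cs_res_uniq _ _ _ _ _ h (idm _)) ?compm1 // epull1.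
- move=> i j k h h' h'' a; rewrite epull_comp.
  by rewrite -(@cs_res_uniq _ _ _ _ _ h'' (cs_res h \oc cs_res h')) // compA !cs_resP.
- by move=> i j h a b; rewrite epullD.
Defined.

Definition lim_ext c M N : zmodType := dirlim (ext_sys c M N).

Definition lim_in c M N (i : csub C M) (a : Ext c (cs_dom i) N) :
  lim_ext c M N := @dl_in (ext_sys c M N) i a.

Lemma cs_preim_ex M L (phi : hom M L) (i : csub C L) :
  exists (k : csub C M) (r : hom (cs_dom k) (cs_dom i)),
    is_pullback (cs_inc i) phi r (cs_inc k).
Proof.
have [P [r [p pb]]] := pullback_ex (cs_inc i) phi.
have mp : is_mono p by apply: pullback_mono pb _; apply: cs_mono.
have [_ Cp] : Ciso C p by apply: (Ciso_pull thC pb); apply: csub_Ciso.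
by exists (Csub mp Cp), r.
Qed.

(* The preimage of a subobject L' <= L, and its map to L'. *)
Definition cs_preim M L (phi : hom M L) (i : csub C L) : csub C M :=
  sval (cid (cs_preim_ex phi i)).

Definition cs_preim_map M L (phi : hom M L) (i : csub C L) :
    hom (cs_dom (cs_preim phi i)) (cs_dom i) :=
  sval (cid (proj2_sig (cid (cs_preim_ex phi i)))).

Lemma cs_preimP M L (phi : hom M L) (i : csub C L) :
  is_pullback (cs_inc i) phi (cs_preim_map phi i) (cs_inc (cs_preim phi i)).
Proof. exact: proj2_sig (cid (proj2_sig (cid (cs_preim_ex phi i)))). Qed.

Definition lim_ext_map c M L N P (phi : hom M L) (psi : hom N P) :
    lim_ext c L N -> lim_ext c M P :=
  @dl_lift (ext_sys c L N) (lim_ext c M P)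
    (fun i a => lim_in (epull (cs_preim_map phi i) (epush psi a))).

Lemma lim_ext_mapE c M L N P (phi : hom M L) (psi : hom N P) (i : csub C L)
    (a : Ext c (cs_dom i) N) :
  lim_ext_map phi psi (lim_in a)
  = lim_in (epull (cs_preim_map phi i) (epush psi a)).
Proof.
apply: (dl_liftE (D := ext_sys c L N)) => {a}i j h a /=.
have pi := cs_preimP phi i; have pj := cs_preimP phi j.
have [|k [k1 k2]] := pullback_lift (u := cs_res h \oc cs_preim_map phi j)
                     (v := cs_inc (cs_preim phi j)) pi.
  by rewrite compA cs_resP pj.1.
have le : cs_le (cs_preim phi i) (cs_preim phi j) by exists k.
rewrite -epull_push epull_comp -k1 (@cs_res_uniq _ _ _ _ _ le _ k2) -epull_comp.
exact: (@dl_in_map (ext_sys c M P)).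
Qed.

Definition iso_inv (B : preadd) (x y : B) (f : hom x y) (isof : is_iso f) :
  hom y x := sval (cid isof).

Lemma iso_invP (B : preadd) (x y : B) (f : hom x y) (isof : is_iso f) :
  iso_inv isof \oc f = idm x /\ f \oc iso_inv isof = idm y.
Proof. exact: proj2_sig (cid isof). Qed.

Lemma csub_iso M (i : csub C M) : is_iso (fhom (qfun C) (cs_inc i)).
Proof. exact/(@qhom_iso A C)/csub_Ciso. Qed.

Definition q_ext c M N :
    lim_ext c M N -> Ext c (qfun C M) (qfun C N) :=
  @dl_lift (ext_sys c M N) _
    (fun i a => epull (iso_inv (csub_iso i)) (ext_map (qfun_exact C) a)).

Lemma q_extE c M N (i : csub C M) (a : Ext c (cs_dom i) N) :
  q_ext (lim_in a)
  = epull (iso_inv (csub_iso i)) (ext_map (qfun_exact C) a).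
Proof.
apply: (dl_liftE (D := ext_sys c M N)) => {a}i j h a.
rewrite [ds_map _ _]/= ext_map_pull epull_comp; congr (epull _ _).
apply: (iso_epi (csub_iso j)); rewrite -compA (iso_invP (csub_iso j)).1 compm1.
by rewrite -(cs_resP h) fhom_comp compA (iso_invP (csub_iso i)).1 comp1m.
Qed.

End LimExt.

Arguments q_ext {A} C c M N.
Arguments lim_ext {A} C c M N.

(* Main.v *)
(* An almost split C gives "roofs with subobject legs": a morphism QM -> QN is
   an honest morphism on some M' <= M with M/M' in C, because a roof apex may be
   replaced by a torsion-free subobject, on which the leg to M is a monomorphism.
   Likewise an extension e of M by N can be restricted to some M' so that it comes
   from an extension by a given N' <= N with N/N' in C: take an almost complement
   of E/N'.  This settles c = 0 and c = 1.  For c >= 2 a class is a splice a o e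
   with a in Ext^(c-1)(Z,N) and e in Ext^1(M,Z), and two splices are equal as soon
   as they are linked by moves a' o z_* e = z^* a' o e.  Both factors lift by
   induction, and a move in A/C lifts after shrinking M; so lifting is
   well defined on Ext^c of A/C and inverts the comparison map. *)

Require Import Defs.
From mathcomp Require Import all_boot ssralg.
From mathcomp Require Import boolp.
Import Defs.

Set Implicit Arguments.
Unset Strict Implicit.
Unset Printing Implicit Defensive.

Import GRing.Theory.
Local Open Scope ring_scope.

(** * Splicing an extension of length one with a longer sequence *)

Section Splice.
Variable A : abelian.
Implicit Types M N Z : A.

Lemma exact_from_mono c X N Y Y' (g : hom X Y) (i : hom Y Y') (s : chain c X N) :
  is_mono i -> exact_from (i \oc g) s <-> exact_from g s.
Proof.
move=> mi; have E W (v : hom W X) : i \oc g \oc v = 0 <-> g \oc v = 0.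
  by rewrite -compA; split=> [/(mono0 mi)|->] //; apply: compm0.
by split; apply: exact_from_ker => W v; split=> /E.
Qed.

Definition chain_splice c M Z N (e : chain 1 M Z) (s : chain c.+1 Z N) :
    chain c.+2 M N :=
  existT _ (projT1 e)
    ((projT2 e).1, existT _ (projT1 s) ((projT2 e).2 \oc (projT2 s).1, (projT2 s).2)).

Lemma chain_splice_exact c M Z N (e : chain 1 M Z) (s : chain c.+1 Z N) :
  exact_seq e -> exact_seq s -> exact_seq (chain_splice e s).
Proof.
case: e s => G [d i] [H [p r]] [/= ed [ei mi]] [/= /exact_epi ep er].
split=> //=; split; last exact/exact_from_mono.
have [k [j [u [kj eu ->]]]] := ei.
exists k, j, (u \oc p); split; rewrite ?compA //.
exact: epi_comp.
Qed.

Definition eseq_splice c M Z N (e : eseq 0 M Z) (s : eseq c Z N) : eseq c.+1 M N :=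
  exist _ (chain_splice (sval e) (sval s))
    (chain_splice_exact (proj2_sig e) (proj2_sig s)).

Lemma chain_splice_mor c M Z N M' Z' N' (f : hom M M') (z : hom Z Z')
    (g : hom N N') (e : chain 1 M Z) (s : chain c.+1 Z N) (e' : chain 1 M' Z')
    (s' : chain c.+1 Z' N') :
  chain_mor f z e e' -> chain_mor z g s s' ->
  chain_mor f g (chain_splice e s) (chain_splice e' s').
Proof.
move=> [h [eh zh]] [h' [eh' m]]; exists h; split=> //=.
by exists h'; rewrite -compA eh' compA zh !compA.
Qed.

(** The objects [Z] and [Z'] are kernels of the heads of [e] and [e'], so the map of middle terms
    restricts to them. *)
Lemma chain_splice_mor_inv c M Z N M' Z' N' (f : hom M M') (g : hom N N')
    (e : eseq 0 M Z) (s : eseq c Z N) (e' : eseq 0 M' Z') (s' : eseq c Z' N') :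
  chain_mor f g (sval (eseq_splice e s)) (sval (eseq_splice e' s')) ->
  exists z : hom Z Z',
    chain_mor f z (sval e) (sval e') /\ chain_mor z g (sval s) (sval s').
Proof.
case: e e' s s' => [[G [d i]] [/= _ [ei mi]]] [[G' [d' i']] [/= _ [ei' mi']]].
move=> [[H [p r]] /= _] [[H' [p' r']] /= _] /= [h [eh [h' [eh' m]]]].
have [|z ez] := kernel_lift (u := h \oc i) (exact_kernel mi' ei').
  by rewrite compA eh -compA (exact0 ei) compm0.
exists z; split; first by exists h.
by exists h'; split=> //; apply: mi'; rewrite !compA ez eh' compA.
Qed.

(** [Z] is the image of the second arrow of [s]. *)
Lemma eseq_splice_ex c M N (s : eseq c.+1 M N) :
  exists Z (e : eseq 0 M Z) (t : eseq c Z N), sval s = sval (eseq_splice e t).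
Proof.
case: s => [[G [d [H [d1 r]]]] [/= ed [ed1 er]]].
have [Z [i [p [ki ep E]]]] := ed1.
have xe : exact_seq (existT _ G (d, i) : chain 1 M Z).
  by split=> //=; split; [exact: kernel_exact | exact: kernel_mono ki].
have xt : exact_seq (existT _ H (p, r) : chain c.+1 Z N).
  split=> /=; first exact/exact_epi.
  by move: er; rewrite E => /(exact_from_mono _ _ (kernel_mono ki)).
by exists Z, (exist _ _ xe), (exist _ _ xt); rewrite /= /chain_splice /= E.
Qed.

Definition ysplice c M Z N (a : Yext c Z N) (e : Yext 0 M Z) : Yext c.+1 M N :=
  ycls (eseq_splice (repr e) (repr a)).

Lemma ysplice_cls c M Z N (s : eseq c Z N) (e : eseq 0 M Z) :
  ysplice (ycls s) (ycls e) = ycls (eseq_splice e s).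
Proof.
rewrite /ysplice.
rewrite (yext_lift (f := fun e => ycls (eseq_splice e (repr (ycls s))))).
  apply: (yext_lift (f := fun s => ycls (eseq_splice e s))) => t t' m.
  by apply/ycls_step/chain_splice_mor/m/chain_mor_id.
by move=> t t' m; apply/ycls_step/(chain_splice_mor m)/chain_mor_id.
Qed.

Lemma ysplice_ex c M N (x : Yext c.+1 M N) :
  exists Z (a : Yext c Z N) (e : Yext 0 M Z), x = ysplice a e.
Proof.
elim/ycls_ind: x => s; have [Z [e [t E]]] := eseq_splice_ex s.
exists Z, (ycls t), (ycls e); rewrite ysplice_cls; apply: ycls_step.
by rewrite E; apply: chain_mor_id.
Qed.

(** The maps from [e] to its pushout and from the pullback of [a] to [a] both induce [z] on the
    middle object, hence splice to one morphism. *)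
Lemma ysplice_push c M Z Z' N (z : hom Z Z') (a : Yext c Z' N) (e : Yext 0 M Z) :
  ysplice a (ypush z e) = ysplice (ypull z a) e.
Proof.
elim/ycls_ind: a => s; elim/ycls_ind: e => e.
rewrite (ypush_cls z e) (ypull_cls z s) !ysplice_cls; symmetry; apply: ycls_step.
exact: chain_splice_mor (push_repP z e) (pull_repP z s).
Qed.

Lemma ysplice_pull c M M' Z N (f : hom M' M) (a : Yext c Z N) (e : Yext 0 M Z) :
  ypull f (ysplice a e) = ysplice a (ypull f e).
Proof.
elim/ycls_ind: a => s; elim/ycls_ind: e => e.
rewrite (ypull_cls f e) !ysplice_cls; apply: ypullE.
exact: chain_splice_mor (pull_repP f e) (chain_mor_id _).
Qed.

End Splice.

(** * Exact functors on splices and on sums of extensions *)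

Section SpliceMap.
Variables (A B : abelian) (F : functor A B).
Hypothesis exF : exact_functor F.

Lemma ext_map_splice c (M Z N : A) (a : Yext c Z N) (e : Yext 0 M Z) :
  ext_map exF (ysplice a e : Ext c.+2 M N)
  = ysplice (ext_map exF (a : Ext c.+1 Z N)) (ext_map exF (e : Ext 1 M Z)).
Proof.
elim/ycls_ind: a => s; elim/ycls_ind: e => e.
rewrite ysplice_cls !ext_mapE ysplice_cls; apply: ycls_step.
exists (idm _); rewrite compm1 comp1m; split=> //=.
exists (idm _); rewrite compm1 comp1m; split; last exact: chain_mor_id.
by rewrite fhom_comp.
Qed.

(** Biproducts are chosen, so [F] need not preserve them on the nose. *)
Definition bip_cmp (X Y : A) : hom (F (bip X Y)) (bip (F X) (F Y)) :=
  bpair (fhom F (pr1 X Y)) (fhom F (pr2 X Y)).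

Lemma bip_cmp_nat (X Y X' Y' : A) (f : hom X X') (g : hom Y Y') :
  bipm (fhom F f) (fhom F g) \oc bip_cmp X Y = bip_cmp X' Y' \oc fhom F (bipm f g).
Proof. by rewrite bipm_pair pair_comp -!fhom_comp pr1_bipm pr2_bipm. Qed.

Lemma chain_map_sum c (X N X' N' : A) (s : chain c X N) (s' : chain c X' N') :
  chain_mor (bip_cmp X X') (bip_cmp N N') (chain_map F (chain_sum s s'))
    (chain_sum (chain_map F s) (chain_map F s')).
Proof.
elim: c X X' s s' => [|c IH] X X' /= s s'; first exact: bip_cmp_nat.
by exists (bip_cmp _ _); split; first exact: bip_cmp_nat.
Qed.

Lemma bip_cmp_diag (X : A) : bip_cmp X X \oc fhom F (diag X) = diag (F X).
Proof. by rewrite pair_comp -!fhom_comp pr1_bpair pr2_bpair fhom1. Qed.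

Lemma codiag_bip_cmp (X : A) : codiag (F X) \oc bip_cmp X X = fhom F (codiag X).
Proof. by rewrite bcopair_pair !comp1m -exF.1 /codiag /bcopair !comp1m. Qed.

Lemma ext_mapD c (M N : A) (a b : Ext c M N) :
  ext_map exF (a + b) = ext_map exF a + ext_map exF b.
Proof.
case: c a b => [|c] a b; first exact: exF.1.
have -> : a + b = epull (diag M) (epush (codiag N) (ysum a b : Ext c.+1 _ _)) by [].
rewrite ext_map_pull ext_map_push -codiag_bip_cmp -epush_comp.
(* [bip_cmp] gives a morphism from the image of the sum to the sum of the images. *)
have -> : epush (bip_cmp N N) (ext_map exF (ysum a b : Ext c.+1 _ _)) =
   epull (bip_cmp M M) (ysum (ext_map exF a) (ext_map exF b) : Ext c.+1 _ _).
  elim/ycls_ind: a => s; elim/ycls_ind: b => t.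
  rewrite (ysumE s t) !ext_mapE ysumE; apply: ypushpullE; exact: chain_map_sum.
by rewrite -epull_push epull_comp bip_cmp_diag.
Qed.

End SpliceMap.

(** * Split extensions and vanishing in degree one *)

Section Split.
Variable A : abelian.
Implicit Types M N G : A.

Definition has_section M N (e : eseq 0 M N) : Prop :=
  exists u : hom M (projT1 (sval e)), (projT2 (sval e)).1 \oc u = idm M.

Definition split_chain M N : chain 1 M N :=
  existT _ (bip M N) (pr1 M N, in2 M N).

Lemma split_chain_exact M N : exact_seq (split_chain M N).
Proof.
split; last split=> /=.
- apply/exact_epi/(@epi_of_comp _ _ _ _ _ (in1 M N)).
  rewrite pr1in1; exact: epi_id.
- apply: chase_exact => [|W u e]; first exact: pr1in2.
  exists W, (idm W), (pr2 M N \oc u); split; first exact: epi_id.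
  rewrite compm1; apply: bip_ext; rewrite ?e !compA ?pr1in2 ?comp0m //.
  by rewrite pr2in2 comp1m.
- by apply: (@mono_of_comp _ _ _ _ (pr2 M N)); rewrite pr2in2; apply: mono_id.
Qed.

Definition split_eseq M N : eseq 0 M N := exist _ _ (@split_chain_exact M N).

(** The idempotent [in2 \oc pr2] is zero over [M] and the identity on [N], so the class is its own
    pullback along zero. *)
Lemma ycls_split M N : ycls (split_eseq M N) = 0.
Proof.
have -> : 0 = ypull (0 : hom M M) (ycls (split_eseq M N)).
  by rewrite -(ypush0_pull0 (0 : Yext 0 M N)) ypush0.
symmetry; apply: ypullE; exists (in2 M N \oc pr2 M N).
rewrite /= compm1 compA pr1in2 -compA pr2in2 compm1; split=> //.
by rewrite !comp0m.
Qed.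

(** Backwards, a section of [d'] yields a retraction [r] of [i'], so [r \oc h] retracts [i], and the
    complementary idempotent factors through [d] as a section. *)
Lemma section_step M N (s t : eseq 0 M N) :
  eseq_step s t -> has_section s <-> has_section t.
Proof.
case: s t => [[G [d i]] [/= ed [ei mi]]] [[G' [d' i']] [/= ed' [ei' mi']]].
move=> [/= h [eh im]]; rewrite comp1m in eh; rewrite compm1 in im.
split=> -[/= u du]; first by exists (h \oc u); rewrite compA eh.
have /exact_epi ep := ed.
have [|r er] := kernel_lift (u := idm _ - u \oc d') (exact_kernel mi' ei').
  by rewrite compBr compm1 compA du comp1m subrr.
have ri : r \oc i' = idm N.
  by apply: mi'; rewrite compA er compBl comp1m -compA (exact0 ei') !compm0 subr0 compm1.
have [|v ev] := cokernel_desc (u := idm _ - i \oc (r \oc h)) (exact_cokernel ep ei).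
  by rewrite compBl comp1m -!compA -im ri compm1 subrr.
exists v; apply: ep; rewrite /= -compA ev compBr compm1 (compA d i) (exact0 ei).
by rewrite comp0m subr0 comp1m.
Qed.

Lemma ycls_eq0_section M N (e : eseq 0 M N) : ycls e = 0 -> has_section e.
Proof.
rewrite -ycls_split => /(cls_eqP (@eseq_relP A 0 M N)) R.
have {R} : has_section e <-> has_section (split_eseq M N).
  by elim: R => [x y /section_step|x|x y _ H|x y z _ H _ H'] //;
     [split=> /H | split=> [/H/H'|/H'/H]].
by case=> _; apply; exists (in1 M N); exact: pr1in1.
Qed.

(** The lift [u] and the inclusion [i] map the split sequence to [e] over [f]. *)
Lemma ypull_eq0 M N M' (e : eseq 0 M N) (f : hom M' M)
    (u : hom M' (projT1 (sval e))) :
  (projT2 (sval e)).1 \oc u = f -> ypull f (ycls e) = 0.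
Proof.
case: e u => -[G [d i]] ex u /= du; have [_ [ei _]] := ex.
rewrite -ycls_split; apply: ypullE; exists (bcopair u i).
by rewrite /= bcopair_in2 compm1 comp_copair du (exact0 ei) /bcopair comp0m addr0.
Qed.

End Split.

(** * Subobjects with quotient in [C] and the comparison map *)

Section CSub.
Variables (A : abelian) (C : thick A).
Let thC := thickP C.
Implicit Types M N X : A.
Local Notation Q := (fhom (qfun C)).
Local Notation Qext := (ext_map (qfun_exact C)).

Definition csub_comp M (i : csub C M) (j : csub C (cs_dom i)) : csub C M :=
  Csub (mono_comp (cs_mono (c := i)) (cs_mono (c := j)))
    (Ccoker_comp thC (cs_coker i) (cs_coker j)).

(** A map with cokernel in [C] equalizes [f] and [g]; its image is the subobject. *)
Lemma csub_eq M N (f g : hom M N) : Q f = Q g ->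
  exists i : csub C M, f \oc cs_inc i = g \oc cs_inc i.
Proof.
move=> fg; have [|t [r [[_ Cr] fr]]] := @qhom_eq0 A C _ _ (f - g).
  apply: (@addIr _ (qhom C g)).
  by rewrite -qhom_add addrNK add0r.
have [i [e [ee ei]]] := csub_image Cr; exists i; apply: ee.
by apply/eqP; rewrite -subr_eq0 -!compA ei -compBl fr.
Qed.

Lemma torsion_free_mono M N (f : hom M N) :
  torsion_free C M -> C (ker f) -> is_mono f.
Proof.
move=> tM Ck; apply: monoP => W u /(kernel_lift (kerP f))[v <-].
by have [z _] := tM _ _ (@kerm_mono _ _ _ f) Ck; rewrite (z _ v) compm0.
Qed.

Lemma csub_roof M N (a : hom (qfun C M) (qfun C N)) : almost_split C ->
  exists (i : csub C M) (h : hom (cs_dom i) N), a \oc Q (cs_inc i) = Q h.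
Proof.
move=> as_C; have [T [s [h [[Ks Cs] e]]]] := @qhom_roof A C _ _ a.
have [X [k [mk tX Ck]]] := as_C T.
have m : is_mono (s \oc k).
  by apply: torsion_free_mono => //; apply: (Cker_comp thC) => //; apply: (Cker_mono thC).
exists (Csub m (Ccoker_comp thC Cs Ck)), (h \oc k).
by rewrite [cs_inc _]/= (fhom_comp (qfun C)) compA [a \oc _]e -fhom_comp.
Qed.

Lemma lim_in_eqP c M N (i j : csub C M) (a : Ext c (cs_dom i) N)
    (b : Ext c (cs_dom j) N) :
  lim_in a = lim_in b <->
  exists (k : csub C M) (f : hom (cs_dom k) (cs_dom i)) (g : hom (cs_dom k) (cs_dom j)),
    [/\ cs_inc i \oc f = cs_inc k, cs_inc j \oc g = cs_inc k & epull f a = epull g b].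
Proof.
split=> [/(@dl_in_eqP (ext_sys C c M N))[k [h [h' E]]]|[k [f [g [ef eg E]]]]].
  by exists k, (cs_res h), (cs_res h'); rewrite !cs_resP.
have le : cs_le i k by exists f.
have le' : cs_le j k by exists g.
apply/(@dl_in_eqP (ext_sys C c M N)); exists k, le, le' => /=.
by rewrite -(cs_res_uniq le ef) -(cs_res_uniq le' eg).
Qed.

Lemma lim_in_pull c M N (i k : csub C M) (f : hom (cs_dom k) (cs_dom i))
    (a : Ext c (cs_dom i) N) :
  cs_inc i \oc f = cs_inc k -> lim_in (epull f a : Ext c (cs_dom k) N) = lim_in a.
Proof.
move=> ef; apply/lim_in_eqP; exists k, (idm _), f.
by rewrite compm1 epull1.
Qed.

(** This form avoids the chosen inverse inside [q_ext]. *)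
Lemma q_ext_inE c M N (i : csub C M) (a : Ext c (cs_dom i) N) y :
  q_ext C c M N (lim_in a) = y <-> Qext a = epull (Q (cs_inc i)) y.
Proof.
rewrite q_extE; have [e1 e2] := iso_invP (csub_iso i).
by split=> [<-|->]; rewrite epull_comp ?e1 ?e2 epull1.
Qed.

(** Quantifying over all [M] lets the induction on [c] use this at the middle objects of splices. *)
Definition ext_faithful c N : Prop :=
  forall M (a b : Ext c M N), Qext a = Qext b ->
  exists j : csub C M, epull (cs_inc j) a = epull (cs_inc j) b.

Definition ext_full c N : Prop :=
  forall M (y : Ext c (qfun C M) (qfun C N)),
  exists (i : csub C M) (a : Ext c (cs_dom i) N), Qext a = epull (Q (cs_inc i)) y.

Lemma lim_ind c M N (P : lim_ext C c M N -> Prop) :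
  (forall (i : csub C M) (a : Ext c (cs_dom i) N), P (lim_in a)) -> forall x, P x.
Proof. exact: (@dl_ind (ext_sys C c M N)). Qed.

Lemma ext_faithfulP c N :
  ext_faithful c N <-> forall M, injective (q_ext C c M N).
Proof.
split=> [H M x y|H M a b ab].
  elim/lim_ind: x => i a; elim/lim_ind: y => j b /q_ext_inE.
  rewrite q_extE epull_comp => ab.
  have [k [[f ef] [g eg]]] := cs_dir i j.
  have [|l el] := H _ (epull f a) (epull g b).
    rewrite !ext_map_pull ab epull_comp -!compA -fhom_comp ef -eg fhom_comp.
    by rewrite (compA (iso_inv _)) (iso_invP (csub_iso j)).1 comp1m.
  rewrite -(lim_in_pull a ef) -(lim_in_pull b eg).
  apply/lim_in_eqP; exists (csub_comp l), (cs_inc l), (cs_inc l).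
  by split.
have [|k [f [g [ef eg E]]]] := (lim_in_eqP (i := csub_full C M) (j := csub_full C M) a b).1.
  by apply: H; rewrite !q_extE; congr (epull _ _).
by exists k; rewrite -{1}ef -eg /= !comp1m.
Qed.

Lemma ext_fullP c N :
  ext_full c N <-> forall M y, exists x, q_ext C c M N x = y.
Proof.
split=> H M y.
  by have [i [a /q_ext_inE E]] := H M y; exists (lim_in a).
have [x] := H M y; elim/lim_ind: x => i a /q_ext_inE; by exists i, a.
Qed.

(** * Degrees zero and one *)

Lemma ext_faithful0 N : ext_faithful 0 N.
Proof. by move=> M a b /csub_eq. Qed.

Lemma ext_full0 N : almost_split C -> ext_full 0 N.
Proof. by move=> as_C M y; have [i [h e]] := csub_roof y as_C; exists i, h. Qed.

(* The pullback of e to an almost complement P of E/N': P meets N/N' trivially,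
   so P -> E/N' -> M is a monomorphism. *)
Lemma yext_shrink M N N' (e : Yext 0 M N) (k : hom N' N) : almost_split C ->
  is_mono k -> C (coker k) ->
  exists (j : csub C M) (e' : Yext 0 (cs_dom j) N'),
    ypull (cs_inc j) e = ypush k e'.
Proof.
move=> as_C mk Ck; elim/ycls_ind: e => -[[G [d i]] ex].
have [/= /exact_epi ed [ei mi]] := ex.
pose q := cokerm (i \oc k).
have [|dl edl] := cokernel_desc (u := d) (cokerP (i \oc k)).
  by rewrite compA (exact0 ei) comp0m.
(* The kernel of [G/N' -> M] is a quotient of [N/N']. *)
have Cdl : C (ker dl).
  have [|m em] := cokernel_desc (u := q \oc i) (cokerP k).
    by rewrite -compA comp_cokerm.
  have [|l el] := kernel_lift (u := m) (kerP dl).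
    apply: (@cokerm_epi _ _ _ k).
    by rewrite -compA em compA edl (exact0 ei) comp0m.
  apply: (thick_quo thC (p := l)) Ck; apply: chase_epi => W u.
  have [W' [s [v [es ev]]]] := epi_chase (kerm dl \oc u) (@cokerm_epi _ _ _ (i \oc k)).
  have [|W2 [s2 [v2 [es2 ev2]]]] := exact_chase (u := v) ei.
    by rewrite -edl -compA ev !compA comp_kerm !comp0m.
  exists W2, (s \oc s2), (cokerm k \oc v2); split; first exact: epi_comp.
  apply: (@kerm_mono _ _ _ dl).
  by rewrite compA el compA em -compA ev2 compA ev !compA.
have [P [x [mx tP Cx]]] := as_C (coker (i \oc k)).
have mj : is_mono (dl \oc x).
  by apply: torsion_free_mono => //; apply: (Cker_comp thC) => //; apply: (Cker_mono thC).
have Cj : C (coker (dl \oc x)).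
  apply: (Ccoker_comp thC) => //; apply: (Ccoker_epi thC).
  by apply: (@epi_of_comp _ _ _ _ dl q); rewrite edl.
(* [G'] is the preimage of [P] in [G]; the kernel of [G' -> P] is that of [q], namely [N']. *)
have [G' [u [p pb]]] := pullback_ex q x.
have [|i' [ei' pi']] := pullback_lift (u := i \oc k) (v := 0) pb.
  by rewrite comp_cokerm compm0.
have mik : is_mono (i \oc k) by apply: mono_comp.
have ex' : exact_seq (existT _ G' (p, i') : chain 1 P N').
  split=> /=; last split.
  - exact/exact_epi/(pullback_epi pb)/cokerm_epi.
  - apply/kernel_exact/mk_kernel => //.
      by apply: (@mono_of_comp _ _ _ _ u); rewrite ei'.
    move=> W v pv.
    have [|t et] := kernel_lift (u := u \oc v) (mono_kernel mik (cokerP _)).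
      by rewrite compA pb.1 -compA pv compm0.
    exists t; apply: (pullback_ext pb); first by rewrite compA ei'.
    by rewrite compA pi' comp0m.
  - by apply: (@mono_of_comp _ _ _ _ u); rewrite ei'.
exists (Csub mj Cj), (ycls (exist _ _ ex' : eseq 0 P N')); symmetry; apply: ypushpullE.
by exists u; split; rewrite /= ?ei' // -edl -compA pb.1 compA.
Qed.

(** By additivity it suffices to treat classes that become zero. A section in the quotient is an
    honest [h] on a subobject of [M]; after shrinking, [d \oc h] is the inclusion. *)
Lemma ext_faithful1 N : almost_split C -> ext_faithful 1 N.
Proof.
move=> as_C M.
suff H (e : Yext 0 M N) : Qext (e : Ext 1 M N) = 0 ->
    exists j : csub C M, ypull (cs_inc j) e = 0.
  move=> a b ab; have [|j ej] := H (a - b).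
    apply: (@addIr _ (Qext b)).
    by rewrite -(ext_mapD (qfun_exact C) (c := 1) (a - b : Ext 1 M N)) addrNK add0r.
  exists j; rewrite -[a](subrK b) epullD.
  by rewrite [X in X + _]ej add0r.
elim/ycls_ind: e => -[[G [d i]] ex]; rewrite ext_mapE => /ycls_eq0_section H.
have {H} [u du] : exists u : hom (qfun C M) (qfun C G), Q d \oc u = idm _ := H.
have [k [h eh]] := csub_roof u as_C.
have [|j ej] := csub_eq (f := d \oc h) (g := cs_inc k).
  by rewrite fhom_comp -eh compA du comp1m.
exists (csub_comp j); apply: (@ypull_eq0 _ _ _ _ (exist _ _ ex : eseq 0 M N) _ (h \oc cs_inc j)).
by rewrite /= compA ej.
Qed.

(** A representative [d'] of the head has image [M'] with [M/M'] in [C], which gives an honest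
    extension of [M'] by [ker p]. Its kernel maps to [N] only in the quotient, by [ka]; an honest
    [v] on a subobject of [ker p] represents [ka], and [yext_shrink] moves the extension there
    before it is pushed along [v]. *)
Lemma ext_full1 N : almost_split C -> ext_full 1 N.
Proof.
move=> as_C M y; elim/ycls_ind: y => -[[E [d i]] ex].
have [/exact_epi ed [ei mi]] :
  exact d (0 : hom (qfun C M) (zob : serre C)) /\ exact i d /\ is_mono i := ex.
have [ep [d' ed']] := csub_roof d as_C.
have ed'' : is_epi (Q d').
  by rewrite -ed'; apply: epi_comp => //; apply/iso_epi/csub_iso.
have [M' [m [p [mm epp emp]]]] := image_ex d'.
have Cm : C (coker m).
  by apply: (Ccoker_of_comp thC (f := p)); rewrite -emp; apply: qhom_epi_inv.
have [|ka eka] := kernel_lift (u := Q (cs_inc ep \oc kerm p)) (exact_kernel mi ei).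
  rewrite fhom_comp compA ed' emp -fhom_comp -compA comp_kerm compm0.
  exact: qhom_0.
have xe : exact_seq (existT _ (cs_dom ep) (p, kerm p) : chain 1 M' (ker p)).
  split=> /=; first exact/exact_epi.
  by split; [exact/kernel_exact/kerP | exact: kerm_mono].
have [k [v ev]] := csub_roof ka as_C.
pose e : Ext 1 M' (ker p) := ycls (exist _ _ xe : eseq 0 M' (ker p)).
have [j [e' ee']] := yext_shrink e as_C (cs_mono (c := k)) (cs_coker k).
exists (csub_comp (i := Csub mm Cm) j), (epush v (e' : Ext 1 _ _)).
set s := ycls _.
have em : epush ka (Qext e) = epull (Q m) (s : Ext 1 (qfun C M) (qfun C N)).
  rewrite /e ext_mapE; apply: ypushpullE; exists (Q (cs_inc ep)).
  split; last exact: etrans eka (qhom_comp _ _ _).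
  by apply: etrans ed' _; rewrite emp; exact: qhom_comp.
rewrite ext_map_push -ev -epush_comp -ext_map_push.
have <- : epull (cs_inc j) e = epush (cs_inc k) (e' : Ext 1 _ _) by [].
by rewrite ext_map_pull -epull_push em epull_comp -fhom_comp.
Qed.

(** * Degrees at least two: lifting splices from the quotient *)

Section Lifts.
Variables (c : nat) (M N : A).
Hypotheses (as_C : almost_split C) (faithful_N : ext_faithful c.+1 N)
  (full_N : ext_full c.+1 N).
Implicit Types Z : A.

(* x is represented by a splice (a', e') over some Z' -> Z invertible in A/C,
   which becomes (a, e) in A/C. *)
Definition lifts Z (a : Yext c (qfun C Z) (qfun C N))
    (e : Yext 0 (qfun C M) (qfun C Z)) (x : lim_ext C c.+2 M N) : Prop :=
  exists (i : csub C M) (Z' : A) (w : hom Z' Z) (a' : Yext c Z' N)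
         (e' : Yext 0 (cs_dom i) Z'),
    [/\ x = lim_in (ysplice a' e' : Ext c.+2 (cs_dom i) N), is_iso (Q w),
        Qext (a' : Ext c.+1 Z' N) = ypull (Q w) a
      & ypush (Q w) (Qext (e' : Ext 1 _ Z')) = ypull (Q (cs_inc i)) e].

Lemma lifts_q Z (a : Yext c (qfun C Z) (qfun C N))
    (e : Yext 0 (qfun C M) (qfun C Z)) x :
  lifts a e x -> q_ext C c.+2 M N x = ysplice a e.
Proof.
case=> i [Z' [w [a' [e' [-> _ ea ee]]]]]; apply/q_ext_inE.
rewrite ext_map_splice ea.
rewrite -[LHS]ysplice_push ee.
by rewrite -[LHS]ysplice_pull.
Qed.

(** Lifting [a] replaces [Z] by a subobject; [e] is carried there by the inverse in the quotient and
    then lifted. *)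
Lemma lifts_ex Z (a : Yext c (qfun C Z) (qfun C N))
    (e : Yext 0 (qfun C M) (qfun C Z)) : exists x, lifts a e x.
Proof.
have [j [a' ea]] := full_N a.
have [u [uj ju]] := csub_iso j.
have [i [e' ee]] := ext_full1 as_C (ypush u e : Ext 1 (qfun C M) (qfun C (cs_dom j))).
exists (lim_in (ysplice a' e' : Ext c.+2 (cs_dom i) N)), i, (cs_dom j), (cs_inc j), a', e'.
split=> //; first exact: csub_iso.
rewrite ee -[LHS]ypull_push; congr (ypull _ _).
by rewrite ypush_comp ju ypush1.
Qed.

Lemma lifts_of (x : lim_ext C c.+2 M N) :
  exists Z (a : Yext c (qfun C Z) (qfun C N)) (e : Yext 0 (qfun C M) (qfun C Z)),
    lifts a e x.
Proof.
elim/lim_ind: x => i s; have [Z [a [e E]]] := ysplice_ex s.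
exists Z, (Qext (a : Ext c.+1 Z N)).
exists (ypull (iso_inv (csub_iso i)) (Qext (e : Ext 1 (cs_dom i) Z))).
exists i, Z, (idm Z), a, e; rewrite fhom1 E ypull1 ypush1; split=> //.
  exact: iso_id.
by rewrite ypull_comp (iso_invP (csub_iso i)).1 ypull1.
Qed.

(** Each of the two relations of a move holds between the lifts after shrinking: the one on [a]
    inside [Z1], the one on [e] inside [M]. *)
Lemma lifts_uniq Z Z2 (z : hom (qfun C Z) (qfun C Z2))
    (a : Yext c (qfun C Z) (qfun C N)) (e : Yext 0 (qfun C M) (qfun C Z))
    (a2 : Yext c (qfun C Z2) (qfun C N)) (e2 : Yext 0 (qfun C M) (qfun C Z2)) x y :
  a = ypull z a2 -> ypush z e = e2 -> lifts a e x -> lifts a2 e2 y -> x = y.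
Proof.
move=> -> <- [i [Z1 [w [b [f [-> _ eb ef]]]]]] [i2 [Z3 [w2 [b2 [f2 [-> iw2 eb2 ef2]]]]]].
have [k [[h eh] [h2 eh2]]] := cs_dir i i2; have [u2 [uw wu]] := iw2.
(* [v] represents [z] between the lifted middle objects [Z1] and [Z3]. *)
have [t [v ev]] := csub_roof (u2 \oc z \oc Q w) as_C.
have w2v : Q w2 \oc Q v = z \oc Q w \oc Q (cs_inc t).
  by rewrite -ev !compA wu comp1m.
have [|j ej] := faithful_N (a := ypull (cs_inc t) b : Ext c.+1 _ N)
                  (b := ypull v b2 : Ext c.+1 _ N).
  rewrite (ext_map_pull _ (c := c.+1) (cs_inc t) b) eb.
  rewrite (ext_map_pull _ (c := c.+1) v b2) eb2.
  by rewrite [LHS]ypull_comp [RHS]ypull_comp ypull_comp w2v compA.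
pose tj := csub_comp j; pose vj := v \oc cs_inc j.
have {ej} ej : ypull (cs_inc tj) b = ypull vj b2.
  by move: ej; rewrite [LHS]ypull_comp [RHS]ypull_comp.
(* The restriction of [f] now comes from the subobject [tj], where [v] is defined and the pullbacks
   of [b] and [b2] agree. *)
have [l [g eg]] := yext_shrink (ypull h f) as_C (cs_mono (c := tj)) (cs_coker tj).
have [|m em] := ext_faithful1 as_C (a := ypush vj g : Ext 1 _ Z3)
                 (b := ypull (cs_inc l) (ypull h2 f2) : Ext 1 _ Z3).
  (* Pushing along the isomorphism [Q w2] moves the comparison to [Z2], where [ef] and [ef2]
     apply. *)
  have I : injective (ypush (Q w2) : Yext 0 (qfun C (cs_dom l)) _ -> _).
    by apply: (can_inj (g := ypush u2)) => s; rewrite ypush_comp uw ypush1.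
  apply: I.
  rewrite (ext_map_push _ (c := 1) vj g) [LHS]ypush_comp.
  have -> : Q w2 \oc Q vj = z \oc Q w \oc Q (cs_inc tj).
    by rewrite /vj (fhom_comp (qfun C)) compA w2v -compA -fhom_comp.
  rewrite -(ypush_comp (Q (cs_inc tj))) -[ypush (Q (cs_inc tj)) _](ext_map_push _ (c := 1) (cs_inc tj) g).
  rewrite [epush _ _]/= -eg.
  rewrite (ext_map_pull _ (c := 1) (cs_inc l)) (ext_map_pull _ (c := 1) h).
  rewrite (ext_map_pull _ (c := 1) (cs_inc l)) (ext_map_pull _ (c := 1) h2).
  rewrite -[RHS]ypull_push -[in RHS]ypull_push ef2.
  rewrite -(ypush_comp (Q w)) -![ypush (Q w) _]ypull_push ef.
  rewrite -[LHS]ypull_push -!ypull_push; congr (ypull _ _).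
  rewrite !ypull_comp; congr (ypull _ _).
  by rewrite -!fhom_comp eh eh2.
pose q := csub_comp m.
pose p := csub_comp q.
have ep : cs_inc i \oc (h \oc cs_inc l \oc cs_inc m) = cs_inc p.
  by rewrite /= !compA eh.
have ep2 : cs_inc i2 \oc (h2 \oc cs_inc l \oc cs_inc m) = cs_inc p.
  by rewrite /= !compA eh2.
rewrite -(lim_in_pull (k := p) (ysplice b f : Ext c.+2 _ N) ep).
rewrite -(lim_in_pull (k := p) (ysplice b2 f2 : Ext c.+2 _ N) ep2); congr lim_in.
rewrite [LHS]ysplice_pull [RHS]ysplice_pull -!ypull_comp.
move: em; rewrite [LHS]/= [RHS]/= => <-.
(* Over [p]: [b o tj_* g = tj^* b o g = vj^* b2 o g = b2 o vj_* g]. *)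
by rewrite eg !ypull_push !ysplice_push ej.
Qed.

(** Lifts are attached to sequences because the relation defining [Ext] is generated on them. *)
Definition seq_lifts (s : eseq c.+1 (qfun C M) (qfun C N)) x : Prop :=
  exists Z (a : eseq c (qfun C Z) (qfun C N)) (e : eseq 0 (qfun C M) (qfun C Z)),
    sval s = sval (eseq_splice e a) /\ lifts (ycls a) (ycls e) x.

Lemma seq_lifts_ex s : exists x, seq_lifts s x.
Proof.
have [Z [e [a E]]] := eseq_splice_ex s.
have [x H] := lifts_ex (Z := Z) (ycls a) (ycls e).
by exists x, Z, a, e.
Qed.

Lemma seq_lifts_q s x : seq_lifts s x -> q_ext C c.+2 M N x = ycls s.
Proof.
case=> Z [a [e [E /lifts_q ->]]]; rewrite ysplice_cls; symmetry; apply: ycls_step.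
by rewrite E; apply: chain_mor_id.
Qed.

Lemma seq_lifts_of x : exists s, seq_lifts s x.
Proof.
have [Z [a [e H]]] := lifts_of x.
exists (eseq_splice (repr e) (repr a)), Z, (repr a), (repr e); split=> //.
by rewrite /ycls !reprK.
Qed.

(** A morphism of splices induces a map [z] of middle objects, which is a move. *)
Lemma seq_lifts_step s t x y : eseq_step s t ->
  seq_lifts s x -> seq_lifts t y -> x = y.
Proof.
rewrite /eseq_step => m [Z [a [e [E H]]]] [Z' [a' [e' [E' H']]]].
move: m; rewrite E E' => /chain_splice_mor_inv[z [me ma]].
apply: lifts_uniq H H'; last exact: ypushE me.
by symmetry; apply: ypullE ma.
Qed.

Lemma seq_lifts_rel s t : eseq_rel s t ->
  forall x y, seq_lifts s x -> seq_lifts t y -> x = y.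
Proof.
elim=> {s t} [s t /seq_lifts_step H x y|s x y|s t _ H x y Hx Hy|
              s t u _ H _ H' x y Hx Hy]; first exact: H.
- by apply: seq_lifts_step; apply: chain_mor_id.
- by rewrite (H y x).
(* The intermediate sequence must itself be lifted to link the two ends. *)
have [v Hv] := seq_lifts_ex t; exact: etrans (H x v Hx Hv) (H' v y Hv Hy).
Qed.

(** Both elements lift sequences representing their images; equivalent sequences have the same
    lift. *)
Lemma q_ext_inj : injective (q_ext C c.+2 M N).
Proof.
move=> x y; have [s Hs] := seq_lifts_of x; have [t Ht] := seq_lifts_of y.
rewrite (seq_lifts_q Hs) (seq_lifts_q Ht) => /(cls_eqP (@eseq_relP _ _ _ _)) R.
exact: seq_lifts_rel R _ _ Hs Ht.
Qed.

Lemma q_ext_surj y : exists x, q_ext C c.+2 M N x = y.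
Proof.
elim/ycls_ind: y => s; have [x /seq_lifts_q <-] := seq_lifts_ex s.
by exists x.
Qed.

End Lifts.

(** * Induction on the degree, additivity and naturality *)

Lemma ext_faithful_full c N : almost_split C -> ext_faithful c N /\ ext_full c N.
Proof.
move=> as_C; case: c => [|c]; first by split; [exact: ext_faithful0 | exact: ext_full0].
(* The induction starts in degree one, since lifting splices passes from [c.+1] to [c.+2]. *)
elim: c => [|c [fN FN]]; first by split; [exact: ext_faithful1 | exact: ext_full1].
split; [apply/ext_faithfulP => M | apply/ext_fullP => M].
  exact: q_ext_inj.
exact: q_ext_surj.
Qed.

Lemma q_extD c M N : zmod_morphism (q_ext C c M N).
Proof.
have qD (x y : lim_ext C c M N) : q_ext C c M N (x + y) = q_ext C c M N x + q_ext C c M N y.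
  have [i [a [b [-> ->]]]] := dl_common x y.
  rewrite (dl_inD1 (D := ext_sys C c M N)).
  rewrite -[dl_in a]/(lim_in a) -[dl_in b]/(lim_in b) -[dl_in (a + b)]/(lim_in (a + b)) !q_extE.
  by rewrite -epullD -ext_mapD.
by move=> x y; apply: (@addIr _ (q_ext C c M N y)); rewrite -qD !subrK.
Qed.

(** Both sides are pullbacks of one class along maps that agree by the square defining the
    preimage. *)
Lemma q_ext_nat c M L N P (phi : hom M L) (psi : hom N P) (x : lim_ext C c L N) :
  q_ext C c M P (lim_ext_map phi psi x) =
  epull (fhom (qfun C) phi) (epush (fhom (qfun C) psi) (q_ext C c L N x)).
Proof.
elim/lim_ind: x => i a; rewrite lim_ext_mapE; apply/q_ext_inE.
rewrite q_extE ext_map_pull ext_map_push -!epull_push !epull_comp; congr (epull _ _).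
rewrite -(fhom_comp (qfun C)) -(cs_preimP phi i).1 (fhom_comp (qfun C)) compA.
by rewrite (iso_invP (csub_iso i)).1 comp1m.
Qed.

End CSub.

Theorem theorem1p1 (A : abelian) (C : thick A)
    (C_almost_split : almost_split C) (C_localizing : localizing C) (c : nat) :
  (forall (M L N P : A) (phi : hom M L) (psi : hom N P) (x : lim_ext C c L N),
      q_ext C c M P (lim_ext_map phi psi x) =
      epull (fhom (qfun C) phi) (epush (fhom (qfun C) psi) (q_ext C c L N x)))
  /\
  (forall M N : A, torsion_free C M -> saturated C N ->
      zmod_morphism (q_ext C c M N) /\ bijective (q_ext C c M N)).
Proof.
split=> [M L N P phi psi x|M N _ _]; first exact: q_ext_nat.
split; first exact: q_extD.
have [/ext_faithfulP/(_ M) qI /ext_fullP/(_ M) qS] := ext_faithful_full c N C_almost_split.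
pose r y := sval (cid (qS y)); have qK : cancel r (q_ext C c M N).
  by move=> y; exact: proj2_sig (cid (qS y)).
by exists r => // x; apply: qI.
Qed.
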